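(* Suppose that $\Lambda$ is a (nonempty) row-finite $k$-graph without sources, and that $R$ is a commutative ring with $1$. Then $\mathrm{KP}_R(\Lambda)$ is simple if and only if $R$ is a field and $\Lambda$ is aperiodic and cofinal.
   Context: Conventions: $\mathbb{N}$ includes $0$, and $k$ is a positive integer. For $m,n\in\mathbb{N}^k$, $m\le n$ is coordinatewise and $m\vee n$ is the coordinatewise maximum. Rings and $R$-algebras are associative but not assumed to have an identity; ideals are two-sided. A ring is simple if it is nonzero (with nonzero multiplication) and has no ideals other than zero and itself. A $k$-graph is a countable category $\Lambda$ (with object set $\Lambda^0$, set of morphisms also written $\Lambda$, domain map $s$, codomain map $r$; $\lambda\mu$ is defined when $s(\lambda)=r(\mu)$) together with a functor $d:\Lambda\to\mathbb{N}^k$ (where $\mathbb{N}^k$ is viewed as a category with one object) with the factorization property: if $d(\lambda)=m+n$ there are unique $\mu,\nu\in\Lambda$ with $d(\mu)=m$, $d(\nu)=n$, $\lambda=\mu\nu$. Objects are identified with identity morphisms, so $\Lambda^0=d^{-1}(0)$. Nonempty means $\Lambda^0\neq\emptyset$. Write $\Lambda^n=d^{-1}(n)$, $v\Lambda=\{\lambda\in\Lambda:r(\lambda)=v\}$, $v\Lambda^n=v\Lambda\cap\Lambda^n$ and $v\Lambda w=\{\lambda\in v\Lambda:s(\lambda)=w\}$. $\Lambda$ is row-finite if every $v\Lambda^n$ ($v\in\Lambda^0$, $n\in\mathbb{N}^k$) is finite, and has no sources if every $v\Lambda^n$ is nonempty. For $\lambda\in\Lambda$ and $0\le m\le n\le d(\lambda)$,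 write $\lambda=\lambda'\lambda''\lambda'''$ uniquely with $d(\lambda')=m$, $d(\lambda'')=n-m$, $d(\lambda''')=d(\lambda)-n$, and put $\lambda(m,n):=\lambda''$. $\Lambda$ is aperiodic if for every $v\in\Lambda^0$ and all $m\neq n$ in $\mathbb{N}^k$ there is $\lambda\in v\Lambda$ with $d(\lambda)\ge m\vee n$ and $\lambda(m,m+d(\lambda)-(m\vee n))\neq\lambda(n,n+d(\lambda)-(m\vee n))$. Let $\Omega_k$ be the $k$-graph with objects $\mathbb{N}^k$, morphisms $(p,q)$ with $p\le q$ in $\mathbb{N}^k$, $r(p,q)=p$, $s(p,q)=q$, $(p,q)(q,t)=(p,t)$, $d(p,q)=q-p$. An infinite path in $\Lambda$ is a degree-preserving functor $x:\Omega_k\to\Lambda$; write $x(n)$ for the vertex $x(n,n)$ and $\Lambda^\infty$ for the set of infinite paths. $\Lambda$ is cofinal if for every $x\in\Lambda^\infty$ and $v\in\Lambda^0$ there is $n\in\mathbb{N}^k$ with $v\Lambda x(n)\neq\emptyset$. Let $\Lambda^{\neq0}=\{\lambda\in\Lambda:d(\lambda)\neq0\}$. For each $\lambda\in\Lambda^{\neq0}$ introduce a formal symbol $\lambda^*$ (ghost path), and let $G(\Lambda^{\neq0})=\{\lambda^*:\lambda\in\Lambda^{\neq0}\}$. A Kumjian-Pask $\Lambda$-family $(P,S)$ in an $R$-algebra $A$ consists of functions $P:\Lambda^0\to A$ and $S:\Lambda^{\neq0}\cup G(\Lambda^{\neq0})\to A$ such that: (KP1) $\{P_v:v\in\Lambda^0\}$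 is a family of mutually orthogonal idempotents; (KP2) for all $\lambda,\mu\in\Lambda^{\neq0}$ with $r(\mu)=s(\lambda)$: $S_\lambda S_\mu=S_{\lambda\mu}$, $S_{\mu^*}S_{\lambda^*}=S_{(\lambda\mu)^*}$, $P_{r(\lambda)}S_\lambda=S_\lambda=S_\lambda P_{s(\lambda)}$, $P_{s(\lambda)}S_{\lambda^*}=S_{\lambda^*}=S_{\lambda^*}P_{r(\lambda)}$; (KP3) for all $\lambda,\mu\in\Lambda^{\neq0}$ with $d(\lambda)=d(\mu)$: $S_{\lambda^*}S_\mu=\delta_{\lambda,\mu}P_{s(\lambda)}$; (KP4) for all $v\in\Lambda^0$ and $n\in\mathbb{N}^k\setminus\{0\}$: $P_v=\sum_{\lambda\in v\Lambda^n}S_\lambda S_{\lambda^*}$. The Kumjian-Pask algebra $\mathrm{KP}_R(\Lambda)$ is the $R$-algebra generated by a universal Kumjian-Pask $\Lambda$-family $(p,s)$ (the free $R$-algebra on $\Lambda^0\cup\Lambda^{\neq0}\cup G(\Lambda^{\neq0})$ modulo the relations (KP1)-(KP4)). *)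

(* Defs.v *)
From HB Require Import structures.
From mathcomp Require Import all_boot all_order all_algebra.
From mathcomp Require Import finmap generic_quotient.
From mathcomp.classical Require Import boolp classical_sets cardinality.

Set Implicit Arguments.
Unset Strict Implicit.
Unset Printing Implicit Defensive.

Import GRing.Theory.

Local Open Scope classical_set_scope.
Local Open Scope ring_scope.

(* Addition and 0 are the pointwise ones of the nmodType {ffun _ -> nat}. *)
Definition Nk (k : nat) := {ffun 'I_k -> nat}.
HB.instance Definition _ k := GRing.Nmodule.on (Nk k).
HB.instance Definition _ k := Countable.on (Nk k).

Definition leNk k (m n : Nk k) : bool := [forall i, (m i <= n i)%N].
Definition joinNk k (m n : Nk k) : Nk k := [ffun i => maxn (m i) (n i)].
(* Truncated; only used below when n <= m coordinatewise. *)
Definition subNk k (m n : Nk k) : Nk k := [ffun i => (m i - n i)%N].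

Lemma leNkP k (m n : Nk k) : reflect (forall i, (m i <= n i)%N) (leNk m n).
Proof. exact: forallP. Qed.

Lemma leNk_refl k (m : Nk k) : leNk m m.
Proof. by apply/leNkP. Qed.

Lemma leNk_trans k (n m p : Nk k) : leNk m n -> leNk n p -> leNk m p.
Proof.
by move=> /leNkP mn /leNkP np; apply/leNkP => i; apply: leq_trans (np i).
Qed.

Lemma addNkE k (m n : Nk k) i : (m + n) i = (m i + n i)%N.
Proof. by rewrite /GRing.add /= ffunE. Qed.

Lemma Nk0E k i : (0 : Nk k) i = 0%N.
Proof. by rewrite /GRing.zero /= ffunE. Qed.

Lemma leNk_addr k (m n : Nk k) : leNk m (m + n).
Proof. by apply/leNkP => i; rewrite addNkE leq_addr. Qed.

Lemma subNkK k (m n : Nk k) : leNk m n -> m + subNk n m = n.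
Proof.
by move=> /leNkP mn; apply/ffunP => i; rewrite addNkE ffunE subnKC.
Qed.

Lemma addNkK k (m n : Nk k) : subNk (m + n) m = n.
Proof. by apply/ffunP => i; rewrite ffunE addNkE addKn. Qed.

Lemma Nk_add_eq0l k (m n : Nk k) : m + n = 0 -> m = 0.
Proof.
move=> /ffunP mn0; apply/ffunP => i; have := mn0 i.
by rewrite addNkE Nk0E => /eqP; rewrite addn_eq0 => /andP[/eqP].
Qed.

(* pcomp l m is the composite "l m", meaningful only when src l = rng m;
   its value on non-composable pairs is an arbitrary junk morphism. *)
Record kgraph (k : nat) := KGraph {
  vtx : countType;
  mor : countType;
  src : mor -> vtx;
  rng : mor -> vtx;
  idm : vtx -> mor;
  pcomp : mor -> mor -> mor;
  deg : mor -> Nk k;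
  src_idm : forall v, src (idm v) = v;
  rng_idm : forall v, rng (idm v) = v;
  src_comp : forall l m, src l = rng m -> src (pcomp l m) = src m;
  rng_comp : forall l m, src l = rng m -> rng (pcomp l m) = rng l;
  pcomp_idl : forall l, pcomp (idm (rng l)) l = l;
  pcomp_idr : forall l, pcomp l (idm (src l)) = l;
  pcompA : forall l m n, src l = rng m -> src m = rng n ->
    pcomp l (pcomp m n) = pcomp (pcomp l m) n;
  deg_idm : forall v, deg (idm v) = 0;
  deg_comp : forall l m, src l = rng m -> deg (pcomp l m) = deg l + deg m;
  factorization : forall l (m n : Nk k), deg l = m + n ->
    exists! f : mor * mor,
      [/\ deg f.1 = m, deg f.2 = n, src f.1 = rng f.2 & l = pcomp f.1 f.2]
}.

Section KGraphs.
Context {k : nat}.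
Implicit Types L : kgraph k.

Lemma deg0_idm L (l : mor L) : deg l = 0 -> l = idm (rng l).
Proof.
move=> d0; have [|f [_ U]] := factorization (l := l) (m := 0) (n := 0).
  by rewrite d0 addr0.
have e1 := U (l, idm (src l)); have e2 := U (idm (rng l), l).
move: e2; rewrite e1 => [H|]; last first.
  by split; rewrite //= ?deg_idm ?rng_idm ?pcomp_idr.
suff [] : (l, idm (src l)) = (idm (rng l), l) by [].
by apply: H; split; rewrite //= ?deg_idm ?src_idm ?pcomp_idl.
Qed.

Definition paths L (v : vtx L) (n : Nk k) : set (mor L) :=
  [set l | rng l = v /\ deg l = n].

Definition row_finite L := forall (v : vtx L) n, finite_set (paths v n).

Definition no_sources L := forall (v : vtx L) n, exists l, paths v n l.

Definition is_segment L (l : mor L) (m n : Nk k) (l2 : mor L) : Prop :=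
  exists l1 l3 : mor L,
    [/\ src l1 = rng l2, src l2 = rng l3 & l = pcomp (pcomp l1 l2) l3] /\
    [/\ deg l1 = m, deg l2 = subNk n m & deg l3 = subNk (deg l) n].

(* The path l(m, n); it is l itself (junk) unless m <= n <= deg l. *)
Definition segment L (l : mor L) (m n : Nk k) : mor L :=
  xget l (is_segment l m n).

Definition aperiodic L := forall (v : vtx L) (m n : Nk k), m <> n ->
  exists l : mor L, [/\ rng l = v, leNk (joinNk m n) (deg l) &
    segment l m (m + subNk (deg l) (joinNk m n)) <>
    segment l n (n + subNk (deg l) (joinNk m n))].

Record kgraph_hom (L M : kgraph k) := KGraphHom {
  hom_vtx : vtx L -> vtx M;
  hom_mor : mor L -> mor M;
  hom_src : forall l, src (hom_mor l) = hom_vtx (src l);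
  hom_rng : forall l, rng (hom_mor l) = hom_vtx (rng l);
  hom_idm : forall v, hom_mor (idm v) = idm (hom_vtx v);
  hom_comp : forall l m, src l = rng m ->
    hom_mor (pcomp l m) = pcomp (hom_mor l) (hom_mor m);
  hom_deg : forall l, deg (hom_mor l) = deg l
}.

End KGraphs.

Lemma segmentP k (L : kgraph k) (l : mor L) (m n : Nk k) :
  leNk m n -> leNk n (deg l) ->
  forall l2, is_segment l m n l2 <-> l2 = segment l m n.
Proof.
move=> mn nd.
have [[a c] [[/= da dc ac lE] U1]] :
    exists! f : mor L * mor L, [/\ deg f.1 = n, deg f.2 = subNk (deg l) n,
      src f.1 = rng f.2 & l = pcomp f.1 f.2].
  by apply: factorization; rewrite subNkK.
have [[a1 a2] [[/= da1 da2 a12 aE] U2]] :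
    exists! f : mor L * mor L, [/\ deg f.1 = m, deg f.2 = subNk n m,
      src f.1 = rng f.2 & a = pcomp f.1 f.2].
  by apply: factorization; rewrite subNkK.
have uniq l2 : is_segment l m n l2 -> l2 = a2.
  move=> [l1 [l3 [[s12 s23 lE'] [d1 d2 d3]]]].
  have H : [/\ deg (pcomp l1 l2) = n, deg l3 = subNk (deg l) n,
      src (pcomp l1 l2) = rng l3 & l = pcomp (pcomp l1 l2) l3].
    by rewrite deg_comp // src_comp // d1 d2 subNkK.
  have [ea _] := U1 (_, _) H.
  by have [_ ->] := U2 (l1, l2) (And4 d1 d2 s12 ea).
have seg : is_segment l m n a2.
  exists a1, c; split; split=> //; last by rewrite -aE.
  by rewrite -ac aE src_comp.
move=> l2; rewrite /segment; case: xgetP => [y _ /uniq -> | /(_ a2) //].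
by split=> [/uniq|->].
Qed.

Section Omega.
Variable k : nat.

Definition Omega_mor := {pq : Nk k * Nk k | leNk pq.1 pq.2}.
HB.instance Definition _ := Countable.on Omega_mor.

Definition Omega_src (f : Omega_mor) : Nk k := (val f).2.
Definition Omega_rng (f : Omega_mor) : Nk k := (val f).1.
Definition Omega_id (p : Nk k) : Omega_mor :=
  exist (fun pq => leNk pq.1 pq.2) (p, p) (leNk_refl p).
Definition Omega_comp (f g : Omega_mor) : Omega_mor :=
  insubd f (Omega_rng f, Omega_src g).
Definition Omega_deg (f : Omega_mor) : Nk k := subNk (Omega_src f) (Omega_rng f).

Lemma Omega_compE f g : Omega_src f = Omega_rng g ->
  val (Omega_comp f g) = (Omega_rng f, Omega_src g).
Proof.
move=> fg; rewrite /Omega_comp val_insubd /=.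
have -> // : leNk (Omega_rng f) (Omega_src g).
apply: (leNk_trans (valP f)); move: fg; rewrite /Omega_src => ->.
exact: (valP g).
Qed.

Lemma Omega_morP (f g : Omega_mor) :
  Omega_rng f = Omega_rng g -> Omega_src f = Omega_src g -> f = g.
Proof.
move=> r s; apply: val_inj; move: r s; rewrite /Omega_rng /Omega_src.
by case: (val f) (val g) => [? ?] [? ?] /= -> ->.
Qed.

Lemma Omega_src_comp f g :
  Omega_src f = Omega_rng g -> Omega_src (Omega_comp f g) = Omega_src g.
Proof. by move=> /Omega_compE e; rewrite {1}/Omega_src e. Qed.

Lemma Omega_rng_comp f g :
  Omega_src f = Omega_rng g -> Omega_rng (Omega_comp f g) = Omega_rng f.
Proof. by move=> /Omega_compE e; rewrite {1}/Omega_rng e. Qed.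

Lemma Omega_degK f : Omega_rng f + Omega_deg f = Omega_src f.
Proof. exact: subNkK (valP f). Qed.

Lemma Omega_deg_idm p : Omega_deg (Omega_id p) = 0.
Proof. by apply/ffunP => i; rewrite ffunE subnn Nk0E. Qed.

Lemma Omega_comp_idl f : Omega_comp (Omega_id (Omega_rng f)) f = f.
Proof. by apply: Omega_morP; rewrite ?Omega_rng_comp ?Omega_src_comp. Qed.

Lemma Omega_comp_idr f : Omega_comp f (Omega_id (Omega_src f)) = f.
Proof. by apply: Omega_morP; rewrite ?Omega_rng_comp ?Omega_src_comp. Qed.

Lemma Omega_compA f g h : Omega_src f = Omega_rng g ->
  Omega_src g = Omega_rng h ->
  Omega_comp f (Omega_comp g h) = Omega_comp (Omega_comp f g) h.
Proof.
move=> fg gh.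
by apply: Omega_morP;
  rewrite ?(Omega_rng_comp, Omega_src_comp) ?(Omega_rng_comp, Omega_src_comp).
Qed.

Lemma Omega_deg_comp f g : Omega_src f = Omega_rng g ->
  Omega_deg (Omega_comp f g) = Omega_deg f + Omega_deg g.
Proof.
move=> fg; rewrite {1}/Omega_deg Omega_rng_comp // Omega_src_comp //.
by rewrite -(Omega_degK g) -fg -(Omega_degK f) -addrA addNkK.
Qed.

Lemma Omega_factorization f (m n : Nk k) : Omega_deg f = m + n ->
  exists! g : Omega_mor * Omega_mor,
    [/\ Omega_deg g.1 = m, Omega_deg g.2 = n, Omega_src g.1 = Omega_rng g.2
      & f = Omega_comp g.1 g.2].
Proof.
move=> dE; pose p := Omega_rng f.
pose g1 : Omega_mor :=
  exist (fun pq => leNk pq.1 pq.2) (p, p + m) (leNk_addr p m).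
pose g2 : Omega_mor :=
  exist (fun pq => leNk pq.1 pq.2) (p + m, p + m + n) (leNk_addr (p + m) n).
have c : Omega_src g1 = Omega_rng g2 by [].
exists (g1, g2); split=> [|[h1 h2] /= [d1 d2 s12 fE]].
  split=> //=; rewrite ?/Omega_deg ?addNkK //; apply: Omega_morP.
    by rewrite Omega_rng_comp.
  by rewrite Omega_src_comp // -Omega_degK dE addrA.
have r1 : Omega_rng h1 = p by rewrite /p fE Omega_rng_comp.
have s1 : Omega_src h1 = p + m by rewrite -Omega_degK r1 d1.
have s2 : Omega_src h2 = p + m + n by rewrite -Omega_degK -s12 s1 d2.
by congr pair; apply: Omega_morP; rewrite ?r1 ?s1 ?s2 -?s12 ?s1.
Qed.

Definition Omega : kgraph k :=
  @KGraph k (Nk k) Omega_mor Omega_src Omega_rng Omega_id Omega_comp Omega_deg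
    (fun=> erefl) (fun=> erefl) Omega_src_comp Omega_rng_comp
    Omega_comp_idl Omega_comp_idr Omega_compA Omega_deg_idm Omega_deg_comp
    Omega_factorization.

End Omega.

Definition infinite_path k (L : kgraph k) := kgraph_hom (Omega k) L.

Definition cofinal k (L : kgraph k) :=
  forall (x : infinite_path L) (v : vtx L),
    exists (n : Nk k) (l : mor L), rng l = v /\ src l = hom_vtx x n.

HB.mixin Record Lmodule_hasNonUnitalMul (R : comPzRingType) A
    of GRing.Lmodule R A := {
  numul : A -> A -> A;
  numulA : associative numul;
  numulDl : left_distributive numul +%R;
  numulDr : right_distributive numul +%R;
  numulZl : forall (c : R) a b, numul (c *: a) b = c *: numul a b;
  numulZr : forall (c : R) a b, numul a (c *: b) = c *: numul a b
}.

#[short(type="nuAlgType")]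
HB.structure Definition NonUnitalAlgebra (R : comPzRingType) :=
  { A of GRing.Lmodule R A & Lmodule_hasNonUnitalMul R A }.

Notation "a ** b" := (numul a b) (at level 40, left associativity) : ring_scope.

Section RingNotions.
Context {R : comPzRingType}.
Implicit Types A B : nuAlgType R.

(* Ring ideals: stability under the scalars R is not required. *)
Record two_sided_ideal A (I : set A) : Prop := {
  ideal0 : I 0;
  idealD : forall a b, I a -> I b -> I (a + b);
  idealN : forall a, I a -> I (- a);
  idealMl : forall a b, I b -> I (a ** b);
  idealMr : forall a b, I a -> I (a ** b)
}.

Definition simple_ring A : Prop :=
  (exists a b : A, a ** b <> 0) /\
  forall I : set A, two_sided_ideal I -> I = [set 0] \/ I = setT.

Record nualg_hom A B (f : A -> B) : Prop := {
  nuhomD : forall a b, f (a + b) = f a + f b;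
  nuhomZ : forall (c : R) a, f (c *: a) = c *: f a;
  nuhomM : forall a b, f (a ** b) = f a ** f b
}.

End RingNotions.

Definition is_field (R : comPzRingType) : Prop :=
  (1 : R) <> 0 /\ forall a : R, a <> 0 -> exists b : R, b * a = 1.

Definition nzmor k (L : kgraph k) := {l : mor L | deg l != 0}.
HB.instance Definition _ k (L : kgraph k) := Countable.on (nzmor L).

Section NonzeroPaths.
Context {k : nat} {L : kgraph k}.

Definition nzsrc (l : nzmor L) : vtx L := src (val l).
Definition nzrng (l : nzmor L) : vtx L := rng (val l).
Definition nzdeg (l : nzmor L) : Nk k := deg (val l).

Lemma nzcomp_subproof (l m : nzmor L) :
  nzsrc l = nzrng m -> deg (pcomp (val l) (val m)) != 0.
Proof.
move=> lm; rewrite deg_comp //; apply: contra (valP l) => /eqP.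
by move=> /Nk_add_eq0l ->.
Qed.

Definition nzcomp (l m : nzmor L) (lm : nzsrc l = nzrng m) : nzmor L :=
  exist (fun p => deg p != 0) (pcomp (val l) (val m)) (nzcomp_subproof lm).

(* For n != 0 and a row-finite graph this enumerates the paths of range v and
   degree n without repetition; fset_set is empty (junk) on infinite sets. *)
Definition nzpaths (v : vtx L) (n : Nk k) : {fset nzmor L} :=
  fset_set [set l : nzmor L | nzrng l = v /\ nzdeg l = n].

Lemma nzpathsP (v : vtx L) n l : row_finite L ->
  (l \in nzpaths v n) = (nzrng l == v) && (nzdeg l == n).
Proof.
move=> rf; have fin : finite_set [set l : nzmor L | nzrng l = v /\ nzdeg l = n].
  have -> : [set l : nzmor L | nzrng l = v /\ nzdeg l = n] =
      val @^-1` paths v n by [].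
  by apply: finite_preimage (rf v n) => x y _ _; apply: val_inj.
rewrite in_fset_set //; apply/idP/andP => [|[/eqP lv /eqP ln]].
  by rewrite inE => -[-> ->].
by rewrite inE.
Qed.

(* T l stands for the value of the family at the ghost path of l. *)
Record KP_family (R : comPzRingType) (A : nuAlgType R)
    (P : vtx L -> A) (S T : nzmor L -> A) : Prop := {
  KP1 : forall v w, P v ** P w = if v == w then P v else 0;
  KP2_comp : forall l m (lm : nzsrc l = nzrng m), S l ** S m = S (nzcomp lm);
  KP2_ghost : forall l m (lm : nzsrc l = nzrng m), T m ** T l = T (nzcomp lm);
  KP2_rng : forall l, P (nzrng l) ** S l = S l;
  KP2_src : forall l, S l ** P (nzsrc l) = S l;
  KP2_ghost_src : forall l, P (nzsrc l) ** T l = T l;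
  KP2_ghost_rng : forall l, T l ** P (nzrng l) = T l;
  KP3 : forall l m, nzdeg l = nzdeg m ->
    T l ** S m = if l == m then P (nzsrc l) else 0;
  KP4 : forall v n, n <> 0 -> P v = \sum_(l <- nzpaths v n) S l ** T l
}.

End NonzeroPaths.

(* Non-unital R-algebra expressions in the generators; the algebra is their
   quotient by the least congruence containing the axioms of R-algebras and
   the relations (KP1)-(KP4). *)
Inductive kp_term (R : comPzRingType) k (L : kgraph k) : Type :=
  | TVertex of vtx L
  | TPath of nzmor L
  | TGhost of nzmor L
  | TZero
  | TAdd of kp_term R L & kp_term R L
  | TOpp of kp_term R L
  | TScale of R & kp_term R L
  | TMul of kp_term R L & kp_term R L.

Arguments TVertex R {k L} _.
Arguments TPath R {k L} _.
Arguments TGhost R {k L} _.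
Arguments TZero R {k} L.

HB.instance Definition _ R k (L : kgraph k) := gen_eqMixin (kp_term R L).
HB.instance Definition _ R k (L : kgraph k) := gen_choiceMixin (kp_term R L).

Section KumjianPask.
Variables (R : comPzRingType) (k : nat) (L : kgraph k).
Local Notation term := (kp_term R L).
Local Notation TZero := (TZero R L).
Local Notation TVertex := (TVertex R).
Local Notation TPath := (TPath R).
Local Notation TGhost := (TGhost R).

Inductive kp_eq : term -> term -> Prop :=
  | kp_refl a : kp_eq a a
  | kp_sym a b : kp_eq a b -> kp_eq b a
  | kp_trans a b c : kp_eq a b -> kp_eq b c -> kp_eq a c
  | kp_congD a a' b b' : kp_eq a a' -> kp_eq b b' -> kp_eq (TAdd a b) (TAdd a' b')
  | kp_congN a a' : kp_eq a a' -> kp_eq (TOpp a) (TOpp a')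
  | kp_congZ c a a' : kp_eq a a' -> kp_eq (TScale c a) (TScale c a')
  | kp_congM a a' b b' : kp_eq a a' -> kp_eq b b' -> kp_eq (TMul a b) (TMul a' b')
  | kp_addA a b c : kp_eq (TAdd a (TAdd b c)) (TAdd (TAdd a b) c)
  | kp_addC a b : kp_eq (TAdd a b) (TAdd b a)
  | kp_add0 a : kp_eq (TAdd TZero a) a
  | kp_addN a : kp_eq (TAdd (TOpp a) a) TZero
  | kp_scaleA c d a : kp_eq (TScale c (TScale d a)) (TScale (c * d) a)
  | kp_scale1 a : kp_eq (TScale 1 a) a
  | kp_scaleDr c a b : kp_eq (TScale c (TAdd a b)) (TAdd (TScale c a) (TScale c b))
  | kp_scaleDl c d a : kp_eq (TScale (c + d) a) (TAdd (TScale c a) (TScale d a))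
  | kp_mulA a b c : kp_eq (TMul a (TMul b c)) (TMul (TMul a b) c)
  | kp_mulDl a b c : kp_eq (TMul (TAdd a b) c) (TAdd (TMul a c) (TMul b c))
  | kp_mulDr a b c : kp_eq (TMul a (TAdd b c)) (TAdd (TMul a b) (TMul a c))
  | kp_mulZl c a b : kp_eq (TMul (TScale c a) b) (TScale c (TMul a b))
  | kp_mulZr c a b : kp_eq (TMul a (TScale c b)) (TScale c (TMul a b))
  | kp_KP1 v w : kp_eq (TMul (TVertex v) (TVertex w))
                       (if v == w then TVertex v else TZero)
  | kp_KP2_comp l m (lm : nzsrc l = nzrng m) :
      kp_eq (TMul (TPath l) (TPath m)) (TPath (nzcomp lm))
  | kp_KP2_ghost l m (lm : nzsrc l = nzrng m) :
      kp_eq (TMul (TGhost m) (TGhost l)) (TGhost (nzcomp lm))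
  | kp_KP2_rng l : kp_eq (TMul (TVertex (nzrng l)) (TPath l)) (TPath l)
  | kp_KP2_src l : kp_eq (TMul (TPath l) (TVertex (nzsrc l))) (TPath l)
  | kp_KP2_ghost_src l : kp_eq (TMul (TVertex (nzsrc l)) (TGhost l)) (TGhost l)
  | kp_KP2_ghost_rng l : kp_eq (TMul (TGhost l) (TVertex (nzrng l))) (TGhost l)
  | kp_KP3 l m : nzdeg l = nzdeg m ->
      kp_eq (TMul (TGhost l) (TPath m)) (if l == m then TVertex (nzsrc l) else TZero)
  | kp_KP4 v n : n <> 0 ->
      kp_eq (TVertex v)
            (\big[@TAdd R k L / TZero]_(l <- nzpaths v n) TMul (TPath l) (TGhost l)).

Definition kp_rel : rel term := fun a b => `[< kp_eq a b >].

Lemma kp_rel_refl : reflexive kp_rel.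
Proof. by move=> a; apply/asboolP/kp_refl. Qed.

Lemma kp_rel_sym : symmetric kp_rel.
Proof. by move=> a b; apply/asboolP/asboolP; apply: kp_sym. Qed.

Lemma kp_rel_trans : transitive kp_rel.
Proof.
by move=> b a c /asboolP ab /asboolP bc; apply/asboolP/(kp_trans ab bc).
Qed.

Canonical kp_equiv := EquivRel kp_rel kp_rel_refl kp_rel_sym kp_rel_trans.

Definition KP := {eq_quot kp_equiv}%qT.
HB.instance Definition _ := Choice.on KP.
HB.instance Definition _ := Quotient.on KP.

Local Open Scope quotient_scope.

Definition kp_class (a : term) : KP := \pi_KP a.

Lemma kp_classP a b : kp_class a = kp_class b <-> kp_eq a b.
Proof.
split=> [/eqmodP /asboolP //|ab].
by apply/eqmodP/asboolP.
Qed.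

Lemma kp_classK (x : KP) : kp_class (repr x) = x.
Proof. exact: reprK. Qed.

Lemma kp_repr a : kp_eq (repr (kp_class a)) a.
Proof. by apply/kp_classP; rewrite kp_classK. Qed.

Lemma kp_classW (Q : KP -> Prop) : (forall a, Q (kp_class a)) -> forall x, Q x.
Proof. by move=> Qc x; rewrite -(kp_classK x). Qed.

Definition KP_zero : KP := kp_class TZero.
Definition KP_add (x y : KP) : KP := kp_class (TAdd (repr x) (repr y)).
Definition KP_opp (x : KP) : KP := kp_class (TOpp (repr x)).
Definition KP_scale (c : R) (x : KP) : KP := kp_class (TScale c (repr x)).
Definition KP_mul (x y : KP) : KP := kp_class (TMul (repr x) (repr y)).

Lemma KP_addE a b : KP_add (kp_class a) (kp_class b) = kp_class (TAdd a b).
Proof. by apply/kp_classP/kp_congD; apply: kp_repr. Qed.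
Lemma KP_oppE a : KP_opp (kp_class a) = kp_class (TOpp a).
Proof. by apply/kp_classP/kp_congN; apply: kp_repr. Qed.
Lemma KP_scaleE c a : KP_scale c (kp_class a) = kp_class (TScale c a).
Proof. by apply/kp_classP/kp_congZ; apply: kp_repr. Qed.
Lemma KP_mulE a b : KP_mul (kp_class a) (kp_class b) = kp_class (TMul a b).
Proof. by apply/kp_classP/kp_congM; apply: kp_repr. Qed.

Lemma KP_addA : associative KP_add.
Proof.
elim/kp_classW=> a; elim/kp_classW=> b; elim/kp_classW=> c.
by rewrite !KP_addE; apply/kp_classP/kp_addA.
Qed.
Lemma KP_addC : commutative KP_add.
Proof.
elim/kp_classW=> a; elim/kp_classW=> b.
by rewrite !KP_addE; apply/kp_classP/kp_addC.
Qed.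
Lemma KP_add0 : left_id KP_zero KP_add.
Proof. by elim/kp_classW=> a; rewrite KP_addE; apply/kp_classP/kp_add0. Qed.
Lemma KP_addN : left_inverse KP_zero KP_opp KP_add.
Proof.
by elim/kp_classW=> a; rewrite KP_oppE KP_addE; apply/kp_classP/kp_addN.
Qed.

HB.instance Definition _ :=
  GRing.isZmodule.Build KP KP_addA KP_addC KP_add0 KP_addN.

Lemma KP_scaleA c d (x : KP) : KP_scale c (KP_scale d x) = KP_scale (c * d) x.
Proof.
by elim/kp_classW: x => a; rewrite !KP_scaleE; apply/kp_classP/kp_scaleA.
Qed.
Lemma KP_scale1 : left_id 1 KP_scale.
Proof. by elim/kp_classW=> a; rewrite KP_scaleE; apply/kp_classP/kp_scale1. Qed.
Lemma KP_scaleDr : right_distributive KP_scale +%R.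
Proof.
move=> c; elim/kp_classW=> a; elim/kp_classW=> b.
rewrite /GRing.add /= !(KP_addE, KP_scaleE).
by apply/kp_classP/kp_scaleDr.
Qed.
Lemma KP_scaleDl x : {morph KP_scale^~ x : c d / c + d}.
Proof.
move=> c d; elim/kp_classW: x => a.
by rewrite /= !KP_scaleE [RHS]KP_addE; apply/kp_classP/kp_scaleDl.
Qed.

HB.instance Definition _ := GRing.Zmodule_isLmodule.Build R KP
  KP_scaleA KP_scale1 KP_scaleDr KP_scaleDl.

Lemma KP_mulA : associative KP_mul.
Proof.
elim/kp_classW=> a; elim/kp_classW=> b; elim/kp_classW=> c.
by rewrite !KP_mulE; apply/kp_classP/kp_mulA.
Qed.
Lemma KP_mulDl : left_distributive KP_mul +%R.
Proof.
elim/kp_classW=> a; elim/kp_classW=> b; elim/kp_classW=> c.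
rewrite [X in KP_mul X _]KP_addE !KP_mulE [RHS]KP_addE.
by apply/kp_classP/kp_mulDl.
Qed.
Lemma KP_mulDr : right_distributive KP_mul +%R.
Proof.
elim/kp_classW=> a; elim/kp_classW=> b; elim/kp_classW=> c.
rewrite [X in KP_mul _ X]KP_addE !KP_mulE [RHS]KP_addE.
by apply/kp_classP/kp_mulDr.
Qed.
Lemma KP_mulZl c (x y : KP) : KP_mul (c *: x) y = c *: KP_mul x y.
Proof.
elim/kp_classW: x => a; elim/kp_classW: y => b.
rewrite [X in KP_mul X _]KP_scaleE !KP_mulE [RHS]KP_scaleE.
by apply/kp_classP/kp_mulZl.
Qed.
Lemma KP_mulZr c (x y : KP) : KP_mul x (c *: y) = c *: KP_mul x y.
Proof.
elim/kp_classW: x => a; elim/kp_classW: y => b.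
rewrite [X in KP_mul _ X]KP_scaleE !KP_mulE [RHS]KP_scaleE.
by apply/kp_classP/kp_mulZr.
Qed.

HB.instance Definition _ := Lmodule_hasNonUnitalMul.Build R KP
  KP_mulA KP_mulDl KP_mulDr KP_mulZl KP_mulZr.

Definition kp_p (v : vtx L) : KP := kp_class (TVertex v).
Definition kp_s (l : nzmor L) : KP := kp_class (TPath l).
Definition kp_t (l : nzmor L) : KP := kp_class (TGhost l).

Lemma kp_class_if (b : bool) u v :
  kp_class (if b then u else v) = if b then kp_class u else kp_class v.
Proof. by case: b. Qed.

Lemma kp_class_sum I (r : seq I) (F : I -> term) :
  kp_class (\big[@TAdd R k L / TZero]_(i <- r) F i) = \sum_(i <- r) kp_class (F i).
Proof.
elim: r => [|i r IH]; first by rewrite !big_nil.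
by rewrite !big_cons -IH [RHS]KP_addE.
Qed.

Lemma KP_generators_family : KP_family kp_p kp_s kp_t.
Proof.
split.
- move=> v w; rewrite [LHS]KP_mulE (_ : 0 = KP_zero) // -kp_class_if.
  exact/kp_classP/kp_KP1.
- by move=> l m lm; rewrite [LHS]KP_mulE; apply/kp_classP/kp_KP2_comp.
- by move=> l m lm; rewrite [LHS]KP_mulE; apply/kp_classP/kp_KP2_ghost.
- by move=> l; rewrite [LHS]KP_mulE; apply/kp_classP/kp_KP2_rng.
- by move=> l; rewrite [LHS]KP_mulE; apply/kp_classP/kp_KP2_src.
- by move=> l; rewrite [LHS]KP_mulE; apply/kp_classP/kp_KP2_ghost_src.
- by move=> l; rewrite [LHS]KP_mulE; apply/kp_classP/kp_KP2_ghost_rng.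
- move=> l m lm; rewrite [LHS]KP_mulE (_ : 0 = KP_zero) // -kp_class_if.
  exact/kp_classP/kp_KP3.
- move=> v n n0; under eq_bigr do rewrite [_ ** _]KP_mulE.
  by rewrite -kp_class_sum; apply/kp_classP/kp_KP4.
Qed.

Section Universal.
Variables (A : nuAlgType R) (P : vtx L -> A) (S T : nzmor L -> A).

Fixpoint kp_eval (a : term) : A :=
  match a with
  | Defs.TVertex v => P v
  | Defs.TPath l => S l
  | Defs.TGhost l => T l
  | Defs.TZero => 0
  | TAdd a b => kp_eval a + kp_eval b
  | TOpp a => - kp_eval a
  | TScale c a => c *: kp_eval a
  | TMul a b => kp_eval a ** kp_eval b
  end.

Lemma kp_eval_eq a b : KP_family P S T -> kp_eq a b -> kp_eval a = kp_eval b.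
Proof.
move=> fam; elim=> //=.
- by move=> {}a {}b c _ -> _ ->.
- by move=> ? ? ? ? _ -> _ ->.
- by move=> ? ? _ ->.
- by move=> ? ? ? _ ->.
- by move=> ? ? ? ? _ -> _ ->.
- by move=> *; rewrite addrA.
- by move=> *; rewrite addrC.
- by move=> *; rewrite add0r.
- by move=> *; rewrite addNr.
- by move=> *; rewrite scalerA.
- by move=> *; rewrite scale1r.
- by move=> *; rewrite scalerDr.
- by move=> *; rewrite scalerDl.
- by move=> *; rewrite numulA.
- by move=> *; rewrite numulDl.
- by move=> *; rewrite numulDr.
- by move=> *; rewrite numulZl.
- by move=> *; rewrite numulZr.
- by move=> v w; rewrite (KP1 fam); case: eqP.
- by move=> l m lm; rewrite (KP2_comp fam lm).
- by move=> l m lm; rewrite (KP2_ghost fam lm).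
- by move=> l; rewrite (KP2_rng fam).
- by move=> l; rewrite (KP2_src fam).
- by move=> l; rewrite (KP2_ghost_src fam).
- by move=> l; rewrite (KP2_ghost_rng fam).
- by move=> l m lm; rewrite (KP3 fam lm); case: eqP.
- move=> v n n0; rewrite (KP4 fam v n0).
  by elim: (enum_fset _) => [|l r IH]; rewrite ?big_nil // !big_cons IH.
Qed.

End Universal.

Theorem KP_universal (A : nuAlgType R) (P : vtx L -> A) (S T : nzmor L -> A) :
  KP_family P S T ->
  exists! f : KP -> A, nualg_hom f /\
    [/\ forall v, f (kp_p v) = P v, forall l, f (kp_s l) = S l
      & forall l, f (kp_t l) = T l].
Proof.
move=> fam; pose f (x : KP) := kp_eval P S T (repr x).
have fE a : f (kp_class a) = kp_eval P S T a.
  exact/(kp_eval_eq fam)/kp_repr.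
exists f; split; first (split; first split=> [a b|c a|a b];
  last by split=> x; rewrite fE).
- elim/kp_classW: a => a; elim/kp_classW: b => b.
  by rewrite [a in f a]KP_addE !fE.
- elim/kp_classW: a => a.
  by rewrite [a in f a]KP_scaleE !fE.
- elim/kp_classW: a => a; elim/kp_classW: b => b.
  by rewrite [a in f a]KP_mulE !fE.
move=> g [[gD gZ gM] [gp gs gt]]; apply/funext.
elim/kp_classW=> a; rewrite fE.
have g0 : g 0 = 0 by rewrite -(scale0r 0) gZ scale0r.
elim: a => /= [v|l|l||a IHa b IHb|a IHa|c a IHa|a IHa b IHb].
- by rewrite -gp.
- by rewrite -gs.
- by rewrite -gt.
- by rewrite -g0.
- by rewrite IHa IHb -gD [X in g X]KP_addE.
- rewrite IHa -KP_oppE; apply/eqP.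
  by rewrite eq_sym -addr_eq0 -gD (addNr (kp_class a)) g0.
- by rewrite IHa -gZ [X in g X]KP_scaleE.
- by rewrite IHa IHb -gM [X in g X]KP_mulE.
Qed.

End KumjianPask.

(* Main.v *)
(* Sufficiency. Every element of KP is a combination of s_a s_b* with all b of
   one degree n. If x is nonzero then so is x s_b = sum_a f(a) s_a for some b
   of degree n; fix a0 with f(a0) nonzero. Aperiodicity yields a path l such
   that a0 l and a l have no common extension for each remaining a of degree
   other than d(a0), so s_(a0 l)* x s_(b l) = f(a0) p_(s(l)). Hence a nonzero
   ideal contains a vertex idempotent; the vertices of an ideal form a
   hereditary and saturated set, and if it were proper there would be an
   infinite path outside it, contradicting cofinality.

   Necessity. Paths act by prepending on any space of infinite paths closed
   under shifts and prepending, and KP is represented on the R-valued functions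
   on it. On all infinite paths this gives p_v <> 0 and, looking at the ideal
   a KP, that every a <> 0 is invertible. If no path leads from v to the
   infinite path x, then p_v is in the kernel of the representation on the
   paths that agree with x up to shifts. If shifting by m and by n agree on the
   infinite paths starting at v, write a path of degree m + n from v as l a and
   as l' b with d(l) = m and d(l') = n: then s_a* - s_b* vanishes on infinite
   paths, but not on infinite paths graded by the integers. *)
From HB Require Import structures.
From mathcomp Require Import all_boot all_order all_algebra.
From mathcomp Require Import finmap.
From mathcomp.classical Require Import boolp classical_sets cardinality.
From mathcomp.classical Require Import functions.
Require Import Defs.

Set Implicit Arguments.
Unset Strict Implicit.
Unset Printing Implicit Defensive.

Import GRing.Theory.

Local Open Scope classical_set_scope.
Local Open Scope ring_scope.

(** * Degrees and factorization *)

Section NkFacts.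
Variable k : nat.
Implicit Types m n p : Nk k.

Lemma addNkI m : injective (+%R m).
Proof. by move=> n p e; rewrite -(addNkK m n) e addNkK. Qed.

Lemma leNk_joinl m n : leNk m (joinNk m n).
Proof. by apply/leNkP => i; rewrite ffunE leq_maxl. Qed.

Lemma leNk_joinr m n : leNk n (joinNk m n).
Proof. by apply/leNkP => i; rewrite ffunE leq_maxr. Qed.

Lemma leNk_addl m n : leNk n (m + n).
Proof. by rewrite addrC leNk_addr. Qed.

Lemma leNk_add m n p : leNk (m + n) (m + p) = leNk n p.
Proof. by apply: eq_forallb => i; rewrite !addNkE leq_add2l. Qed.

Lemma leNk0 n : leNk 0 n.
Proof. by rewrite -[n]add0r leNk_addr. Qed.

Lemma leNk_add_subl m n D : leNk (joinNk m n) D ->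
  leNk (m + subNk D (joinNk m n)) D.
Proof.
move=> h; rewrite -[X in leNk _ X](subNkK h) addrC [X in leNk _ X]addrC.
by rewrite leNk_add leNk_joinl.
Qed.

Lemma joinNkC m n : joinNk m n = joinNk n m.
Proof. by apply/ffunP => i; rewrite !ffunE maxnC. Qed.

Lemma leNk_add_subr m n D : leNk (joinNk m n) D ->
  leNk (n + subNk D (joinNk m n)) D.
Proof. by rewrite joinNkC; exact: leNk_add_subl. Qed.

Lemma addNk_sub m n p : leNk n p -> m + subNk p n = subNk (m + p) n.
Proof.
move=> /leNkP np; apply/ffunP => i.
by rewrite addNkE !ffunE -addnBA.
Qed.

End NkFacts.

Section Factorization.
Variables (k : nat) (L : kgraph k).
Implicit Types (l a b c : mor L) (m n p : Nk k).

(** The uniqueness half of the factorization property, in the form of a cancellation law. The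
    degrees of [b] and [b'] agree because addition of degrees is cancellative. *)
Lemma pcomp_inj a b a' b' : deg a = deg a' -> src a = rng b ->
  src a' = rng b' -> pcomp a b = pcomp a' b' -> a = a' /\ b = b'.
Proof.
move=> da ab ab' e.
have db : deg b = deg b'.
  by apply: (@addNkI _ (deg a)); rewrite -deg_comp // e deg_comp // da.
have [f [_ U]] := factorization (deg_comp ab).
have e1 := U (a, b) (And4 erefl erefl ab erefl).
have e2 := U (a', b') (And4 (esym da) (esym db) ab' e).
by move: e2; rewrite e1 => -[-> ->].
Qed.

(* The junk pair [(l, l)] unless [n <= deg l]. *)
Definition fact n l : mor L * mor L :=
  xget (l, l)
    [set f | [/\ deg f.1 = n, src f.1 = rng f.2 & l = pcomp f.1 f.2]].
(** For [n] at most [deg l], [ini n l] is $l(0,n)$ and [rest n l] is $l(n,d(l))$. *)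
Definition ini n l := (fact n l).1.
Definition rest n l := (fact n l).2.

Lemma factP n l : leNk n (deg l) ->
  [/\ deg (ini n l) = n, src (ini n l) = rng (rest n l)
    & l = pcomp (ini n l) (rest n l)].
Proof.
move=> nl; have [f [[f1 f2 sf lf] _]] := factorization (esym (subNkK nl)).
rewrite /ini /rest /fact; case: xgetP => [g _ [] //|/(_ f)].
by case; split.
Qed.

Lemma ini_rest_comp a b : src a = rng b ->
  ini (deg a) (pcomp a b) = a /\ rest (deg a) (pcomp a b) = b.
Proof.
move=> ab; have [|di sir e] := @factP (deg a) (pcomp a b).
  by rewrite deg_comp // leNk_addr.
have [] := @pcomp_inj a b _ _ (esym di) ab sir e.
by move=> <- <-.
Qed.

Lemma ini_comp a b : src a = rng b -> ini (deg a) (pcomp a b) = a.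
Proof. by case/ini_rest_comp. Qed.

Lemma rest_comp a b : src a = rng b -> rest (deg a) (pcomp a b) = b.
Proof. by case/ini_rest_comp. Qed.

Lemma rest_deg l : rest (deg l) l = idm (src l).
Proof. by rewrite -{2}(pcomp_idr l) rest_comp ?rng_idm. Qed.

Lemma rng_ini n l : leNk n (deg l) -> rng (ini n l) = rng l.
Proof. by move=> /factP[_ s e]; rewrite [in RHS]e rng_comp. Qed.

Lemma src_rest n l : leNk n (deg l) -> src (rest n l) = src l.
Proof. by move=> /factP[_ s e]; rewrite [in RHS]e src_comp. Qed.

Lemma deg_rest n l : leNk n (deg l) -> n + deg (rest n l) = deg l.
Proof. by move=> /factP[d s e]; rewrite [in RHS]e deg_comp // d. Qed.

Lemma fact_comp n a b : src a = rng b -> leNk n (deg a) ->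
  ini n (pcomp a b) = ini n a /\ rest n (pcomp a b) = pcomp (rest n a) b.
Proof.
move=> ab na; have [d s e] := factP na.
have sb : src (rest n a) = rng b by rewrite src_rest.
have s' : src (ini n a) = rng (pcomp (rest n a) b) by rewrite rng_comp.
have -> : pcomp a b = pcomp (ini n a) (pcomp (rest n a) b).
  by rewrite {1}e -pcompA.
by have := ini_rest_comp s'; rewrite d.
Qed.

Lemma ini_compl n a b : src a = rng b -> leNk n (deg a) ->
  ini n (pcomp a b) = ini n a.
Proof. by move=> ab /(fact_comp ab)[]. Qed.

Lemma rest_compl n a b : src a = rng b -> leNk n (deg a) ->
  rest n (pcomp a b) = pcomp (rest n a) b.
Proof. by move=> ab /(fact_comp ab)[]. Qed.

Lemma ini_ini m n l : leNk m n -> leNk n (deg l) -> ini m (ini n l) = ini m l.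
Proof.
move=> mn nl; have [d s e] := factP nl.
by rewrite [in RHS]e ini_compl ?d.
Qed.

Lemma rest_add m n l : leNk (m + n) (deg l) ->
  rest (m + n) l = rest n (rest m l).
Proof.
move=> mnl; have ml : leNk m (deg l) by apply: leNk_trans mnl; exact: leNk_addr.
have [d1 s1 e1] := factP ml.
have nr : leNk n (deg (rest m l)) by rewrite -(leNk_add m) deg_rest.
have [d2 s2 e2] := factP nr.
have s12 : src (ini m l) = rng (ini n (rest m l)) by rewrite rng_ini.
rewrite {1}e1 {1}e2 pcompA //.
have -> : m + n = deg (pcomp (ini m l) (ini n (rest m l))).
  by rewrite deg_comp // d1 d2.
by rewrite rest_comp ?src_comp.
Qed.

Lemma rest_ini m n l : leNk (m + n) (deg l) ->
  rest m (ini (m + n) l) = ini n (rest m l).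
Proof.
move=> mnl; have [d s e] := factP mnl.
have ml : leNk m (deg (ini (m + n) l)) by rewrite d leNk_addr.
have nr : n = deg (rest m (ini (m + n) l)).
  by apply: (@addNkI _ m); rewrite deg_rest.
have sr : src (rest m (ini (m + n) l)) = rng (rest (m + n) l).
  by rewrite src_rest.
by rewrite [in RHS]e rest_compl // {2}nr ini_comp.
Qed.

Lemma segment_ini_rest l m D : leNk (m + D) (deg l) ->
  segment l m (m + D) = ini D (rest m l).
Proof.
move=> mDl; have ml : leNk m (deg l) by apply: leNk_trans mDl; exact: leNk_addr.
apply/esym/segmentP => //; first exact: leNk_addr.
have Dr : leNk D (deg (rest m l)) by rewrite -(leNk_add m) deg_rest.
have [d1 s1 e1] := factP ml; have [d2 s2 e2] := factP Dr.
have s12 : src (ini m l) = rng (ini D (rest m l)) by rewrite rng_ini.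
exists (ini m l), (rest D (rest m l)); split; split=> //.
- by rewrite -pcompA // -e2.
- by rewrite d2 addNkK.
- by rewrite -(deg_rest ml) -(deg_rest Dr) addrA addNkK.
Qed.

End Factorization.

(** * Separating paths *)

Section Aperiodicity.
Variables (k : nat) (L : kgraph k).
Implicit Types (l c : mor L) (m n : Nk k).

(** The condition on [l] in the definition of aperiodicity, with both segments rewritten through
    [ini] and [rest]. *)
Definition separates l m n :=
  leNk (joinNk m n) (deg l) /\
  ini (subNk (deg l) (joinNk m n)) (rest m l) <>
  ini (subNk (deg l) (joinNk m n)) (rest n l).

Lemma aperiodicP : aperiodic L <-> forall (v : vtx L) m n, m <> n ->
  exists l, rng l = v /\ separates l m n.
Proof.
split=> ap v m n mn; have [l] := ap v m n mn.
  case=> lv ml; rewrite !segment_ini_rest ?leNk_add_subl ?leNk_add_subr //.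
  by exists l.
case=> lv [ml ne]; exists l; split=> //.
by rewrite !segment_ini_rest ?leNk_add_subl ?leNk_add_subr.
Qed.

(** The segments of [l] are initial parts of the longer segments of [pcomp l c], so agreement of the
    latter would force agreement of the former. *)
Lemma separates_compl l c m n : src l = rng c ->
  separates l m n -> separates (pcomp l c) m n.
Proof.
move=> lc [ml ne]; have mlc : leNk (joinNk m n) (deg (pcomp l c)).
  by rewrite deg_comp //; apply: leNk_trans ml _; exact: leNk_addr.
split=> // e; apply: ne.
set D' := subNk _ _ in e; set D := subNk _ _.
have DD' : leNk D D'.
  by rewrite /D' deg_comp // addrC -addNk_sub // leNk_addl.
have w p : leNk (p + D) (deg l) -> leNk (p + D') (deg (pcomp l c)) ->
    ini D (rest p l) = ini D (ini D' (rest p (pcomp l c))).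
  move=> pD pD'.
  have pl : leNk p (deg l) by apply: leNk_trans pD; exact: leNk_addr.
  have plc : leNk p (deg (pcomp l c)).
    by apply: leNk_trans pD'; exact: leNk_addr.
  rewrite ini_ini //; last by rewrite -(leNk_add p) deg_rest.
  rewrite rest_compl // ini_compl ?src_rest //.
  by rewrite -(leNk_add p) deg_rest.
by rewrite !w ?leNk_add_subl ?leNk_add_subr // e.
Qed.

(** The segments of [l] are what remains of those of [pcomp c l] after removal of an initial part of
    degree [deg c]. *)
Lemma separates_compr l c m n : src c = rng l ->
  separates l m n -> separates (pcomp c l) m n.
Proof.
move=> cl [ml ne]; have mlc : leNk (joinNk m n) (deg (pcomp c l)).
  by rewrite deg_comp //; apply: leNk_trans ml _; exact: leNk_addl.
split=> // e; apply: ne.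
move: e; rewrite deg_comp // -addNk_sub //.
set D := subNk _ _ => e.
have w p : leNk (p + D) (deg l) ->
    ini D (rest p l) = rest (deg c) (ini (deg c + D) (rest p (pcomp c l))).
  move=> pD.
  have pl : leNk p (deg l) by apply: leNk_trans pD; exact: leNk_addr.
  have dcl : leNk (deg c + p) (deg (pcomp c l)) by rewrite deg_comp // leNk_add.
  have pcl : leNk p (deg (pcomp c l)).
    by apply: leNk_trans dcl; exact: leNk_addl.
  rewrite rest_ini; last first.
    by rewrite -(leNk_add p) deg_rest // deg_comp // addrCA leNk_add.
  by rewrite -rest_add ?[p + _]addrC // rest_add // rest_comp.
by rewrite !w ?leNk_add_subl ?leNk_add_subr // e.
Qed.

(** The two segments of [l] that are assumed distinct both sit at position [N] in a common
    extension: $N-d(a)$ steps into [l] is $N$ steps into [pcomp a l], and likewise for [a']. *)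
Lemma separates_no_common_extension l a a' b b' :
  let N := joinNk (deg a) (deg a') in
  separates l (subNk N (deg a)) (subNk N (deg a')) ->
  src a = rng l -> src a' = rng l -> src l = rng b -> src l = rng b' ->
  pcomp (pcomp a l) b <> pcomp (pcomp a' l) b'.
Proof.
move=> N [ml ne] al al' lb lb' e; apply: ne; set D := subNk (deg l) _.
have w c d : leNk (deg c) N -> src c = rng l -> src l = rng d ->
    leNk (subNk N (deg c) + D) (deg l) ->
    ini D (rest (subNk N (deg c)) l) = ini D (rest N (pcomp (pcomp c l) d)).
  move=> cN cl ld cD; set m := subNk _ _ in cD *.
  have mle : leNk m (deg l) by apply: leNk_trans cD; exact: leNk_addr.
  rewrite -(subNkK cN) -/m -pcompA // rest_add; last first.
    rewrite !deg_comp ?rng_comp // leNk_add.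
    by apply: leNk_trans mle _; exact: leNk_addr.
  rewrite rest_comp ?rng_comp // rest_compl // ini_compl ?src_rest //.
  by rewrite -(leNk_add m) deg_rest.
rewrite (w a b) ?(w a' b') ?e ?leNk_joinl ?leNk_joinr //.
  by rewrite leNk_add_subr.
by rewrite leNk_add_subl.
Qed.

(** The path is lengthened once for each pair. Extension on the right keeps the pairs already
    separated, and prefixing the old path keeps the new one. *)
Lemma aperiodic_separates_seq (v : vtx L) (s : seq (Nk k * Nk k)) :
  aperiodic L -> (forall d, d \in s -> d.1 <> d.2) ->
  exists2 l, rng l = v & forall d, d \in s -> separates l d.1 d.2.
Proof.
move=> /aperiodicP ap; elim: s => [|d s IH] sP.
  by exists (idm v); rewrite ?rng_idm.
have [|l lv ls] := IH; first by move=> e es; apply: sP; rewrite inE es orbT.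
have [|c [cl cd]] := ap (src l) d.1 d.2; first by apply: sP; rewrite mem_head.
exists (pcomp l c); first by rewrite rng_comp.
move=> e; rewrite inE => /orP[/eqP->|es]; first exact: separates_compr.
by apply: separates_compl (ls e es).
Qed.

End Aperiodicity.

(** * The Kumjian-Pask relations for all paths *)

Section NonUnitalAlgebras.
Variables (R : comPzRingType) (A : nuAlgType R).
Implicit Types a b : A.

Lemma numul0l a : 0 ** a = 0.
Proof. by rewrite -[X in X ** _](scale0r 0) numulZl scale0r. Qed.

Lemma numul0r a : a ** 0 = 0.
Proof. by rewrite -[X in _ ** X](scale0r 0) numulZr scale0r. Qed.

Lemma numul_suml I (r : seq I) (F : I -> A) b :
  (\sum_(i <- r) F i) ** b = \sum_(i <- r) F i ** b.
Proof.
by elim: r => [|i r IH]; rewrite ?big_nil ?numul0l // !big_cons numulDl IH.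
Qed.

Lemma numul_sumr I (r : seq I) (F : I -> A) a :
  a ** (\sum_(i <- r) F i) = \sum_(i <- r) a ** F i.
Proof.
by elim: r => [|i r IH]; rewrite ?big_nil ?numul0r // !big_cons numulDr IH.
Qed.

Lemma ideal_sum (J : set A) (I : eqType) (r : seq I) (F : I -> A) :
  two_sided_ideal J -> (forall i, i \in r -> J (F i)) -> J (\sum_(i <- r) F i).
Proof.
move=> iJ JF; rewrite big_seq; apply: big_ind; first exact: ideal0.
  by move=> a b; exact: idealD.
exact: JF.
Qed.

End NonUnitalAlgebras.

Section PathLists.
Variables (k : nat) (L : kgraph k).

Lemma mor_ind (Q : mor L -> Prop) :
  (forall v, Q (idm v)) -> (forall l : nzmor L, Q (val l)) -> forall l, Q l.
Proof.
move=> Q0 Q1 l; have [/deg0_idm ->//|d0] := eqVneq (deg l) 0.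
exact: (Q1 (exist _ l d0)).
Qed.

(** Degree 0 is treated apart, since [nzpaths] contains no identity morphisms. *)
Definition pathseq (v : vtx L) (n : Nk k) : seq (mor L) :=
  if n == 0 then [:: idm v] else map val (enum_fset (nzpaths v n)).

Lemma mem_pathseq v n l : row_finite L ->
  (l \in pathseq v n) = (rng l == v) && (deg l == n).
Proof.
move=> rf; rewrite /pathseq; case: ifPn => [/eqP->|n0].
  rewrite inE; apply/eqP/andP => [->|[/eqP<- /eqP/deg0_idm//]].
  by rewrite rng_idm deg_idm !eqxx.
apply/mapP/andP => [[l' + ->]|[lv ln]]; first by rewrite nzpathsP // => /andP.
have d0 : deg l != 0 by rewrite (eqP ln).
by exists (exist _ l d0) => //; rewrite nzpathsP // /nzrng /nzdeg /= lv ln.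
Qed.

End PathLists.

Section ExtendedFamily.
Variables (k : nat) (L : kgraph k) (R : comPzRingType) (A : nuAlgType R).
Variables (P : vtx L -> A) (S T : nzmor L -> A).
Hypothesis rf : row_finite L.
Hypothesis fam : KP_family P S T.

(** Identity morphisms go to vertex idempotents, so that the relations hold in all degrees without
    case distinctions. *)
Definition extend_path (U : nzmor L -> A) (l : mor L) : A :=
  if insub l is Some l' then U l' else P (rng l).

Lemma extend_path_idm U v : extend_path U (idm v) = P v.
Proof. by rewrite /extend_path insubN ?rng_idm // deg_idm eqxx. Qed.

Lemma extend_path_val U (l : nzmor L) : extend_path U (val l) = U l.
Proof. by rewrite /extend_path valK. Qed.

Local Notation s := (extend_path S).
Local Notation t := (extend_path T).
Local Notation ext0 := extend_path_idm.
Local Notation ext1 := extend_path_val.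

Lemma vertex_path l : P (rng l) ** s l = s l.
Proof.
elim/mor_ind: l => [v|l]; first by rewrite ext0 rng_idm (KP1 fam) eqxx.
by rewrite ext1; exact: KP2_rng fam l.
Qed.

Lemma path_vertex l : s l ** P (src l) = s l.
Proof.
elim/mor_ind: l => [v|l]; first by rewrite ext0 src_idm (KP1 fam) eqxx.
by rewrite ext1; exact: KP2_src fam l.
Qed.

Lemma vertex_ghost l : P (src l) ** t l = t l.
Proof.
elim/mor_ind: l => [v|l]; first by rewrite ext0 src_idm (KP1 fam) eqxx.
by rewrite ext1; exact: KP2_ghost_src fam l.
Qed.

Lemma ghost_vertex l : t l ** P (rng l) = t l.
Proof.
elim/mor_ind: l => [v|l]; first by rewrite ext0 rng_idm (KP1 fam) eqxx.
by rewrite ext1; exact: KP2_ghost_rng fam l.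
Qed.

Lemma path_comp l m : src l = rng m -> s l ** s m = s (pcomp l m).
Proof.
elim/mor_ind: l => [v|l].
  by rewrite src_idm => ->; rewrite ext0 vertex_path pcomp_idl.
elim/mor_ind: m => [v|m lm].
  by rewrite rng_idm => <-; rewrite ext0 path_vertex pcomp_idr.
by rewrite !ext1 (KP2_comp fam (lm : nzsrc l = nzrng m)) -ext1.
Qed.

Lemma ghost_comp l m : src l = rng m -> t m ** t l = t (pcomp l m).
Proof.
elim/mor_ind: l => [v|l].
  by rewrite src_idm => ->; rewrite ext0 ghost_vertex pcomp_idl.
elim/mor_ind: m => [v|m lm].
  by rewrite rng_idm => <-; rewrite ext0 vertex_ghost pcomp_idr.
by rewrite !ext1 (KP2_ghost fam (lm : nzsrc l = nzrng m)) -ext1.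
Qed.

Lemma ghost_path l m : deg l = deg m ->
  t l ** s m = if l == m then P (src l) else 0.
Proof.
elim/mor_ind: l => [v|l].
  rewrite deg_idm => /esym/deg0_idm ->; rewrite !ext0 (KP1 fam).
  have [->|vw] := eqVneq v; first by rewrite eqxx src_idm.
  case: eqP => // /(congr1 (@src k L)); rewrite !src_idm => e.
  by rewrite e eqxx in vw.
elim/mor_ind: m => [v|m lm].
  by rewrite deg_idm => e; have := valP l; rewrite /= e eqxx.
rewrite !ext1 (KP3 fam (lm : nzdeg l = nzdeg m)).
by rewrite -(inj_eq val_inj).
Qed.

Lemma path_mul0 l m : src l != rng m -> s l ** s m = 0.
Proof.
move=> lm; rewrite -(path_vertex l) -(vertex_path m) -numulA (numulA (P _)).
rewrite (KP1 fam).
by rewrite (negPf lm) numul0l numul0r.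
Qed.

Lemma vertex_sum v n : P v = \sum_(l <- pathseq v n) s l ** t l.
Proof.
rewrite /pathseq; case: eqP => [_|n0].
  by rewrite big_seq1 !ext0 (KP1 fam) eqxx.
rewrite big_map (KP4 fam v n0); apply: eq_bigr => l _.
by rewrite !ext1.
Qed.

(** Insert between the factors the expansion of the vertex idempotent over paths [g] of degree
    $d(a)\vee d(b)$. A term survives only if [g] extends both [a] and [b]. *)
Lemma ghost_path_orthogonal a b :
  (forall c d, src a = rng c -> src b = rng d -> pcomp a c <> pcomp b d) ->
  t a ** s b = 0.
Proof.
move=> ab; rewrite -vertex_path (vertex_sum _ (joinNk (deg a) (deg b))).
rewrite numul_suml numul_sumr big_seq big1 // => g.
rewrite mem_pathseq // => /andP[_ /eqP dg].
have [ga|ga] := eqVneq (ini (deg a) g) a; last first.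
  have [|d e c] := @factP _ _ (deg a) g; first by rewrite dg leNk_joinl.
  rewrite c -(path_comp e) !numulA ghost_path // eq_sym (negPf ga).
  by rewrite !numul0l.
have [gb|gb] := eqVneq (ini (deg b) g) b; last first.
  have [|d e c] := @factP _ _ (deg b) g; first by rewrite dg leNk_joinr.
  have -> : t g = t (rest (deg b) g) ** t (ini (deg b) g).
    by rewrite ghost_comp // -c.
  rewrite -!numulA ghost_path //.
  by rewrite (negPf gb) !numul0r.
have [|_ e c] := @factP _ _ (deg a) g; first by rewrite dg leNk_joinl.
have [|_ e' c'] := @factP _ _ (deg b) g; first by rewrite dg leNk_joinr.
by rewrite ga in e c; rewrite gb in e' c'; case: (ab _ _ e e'); rewrite -c.
Qed.

(** (KP4) at the common source raises the degree of the ghost path by any [n]; this brings several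
    terms to a common ghost degree. *)
Lemma path_ghost_expand a b n : src a = src b ->
  s a ** t b =
  \sum_(l <- pathseq (src b) n) s (pcomp a l) ** t (pcomp b l).
Proof.
move=> ab; rewrite -path_vertex -numulA (vertex_sum (src a) n).
rewrite ab numul_suml numul_sumr big_seq [RHS]big_seq; apply: eq_bigr => l.
rewrite mem_pathseq // => /andP[/eqP rl _].
by rewrite -path_comp ?ab // -ghost_comp // !numulA.
Qed.

(* Sums of terms [c s_a t_b] in which all the ghost paths [b] have degree [n];
   a term is encoded as [(c, (a, b))]. *)
Definition ghost_span (n : Nk k) (x : A) :=
  exists r : seq (R * (mor L * mor L)),
  (forall i, i \in r -> src i.2.1 = src i.2.2 /\ deg i.2.2 = n) /\
  x = \sum_(i <- r) i.1 *: (s i.2.1 ** t i.2.2).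

Lemma ghost_span0 n : ghost_span n 0.
Proof. by exists [::]; rewrite big_nil. Qed.

Lemma ghost_spanD n x y :
  ghost_span n x -> ghost_span n y -> ghost_span n (x + y).
Proof.
move=> [r [rP ->]] [r' [rP' ->]]; exists (r ++ r'); rewrite big_cat.
by split=> // i; rewrite mem_cat => /orP[/rP|/rP'].
Qed.

Lemma ghost_span_term n c a b : src a = src b -> deg b = n ->
  ghost_span n (c *: (s a ** t b)).
Proof.
by move=> ab bn; exists [:: (c, (a, b))]; rewrite big_seq1; split=> // i;
  rewrite inE => /eqP->.
Qed.

Lemma ghost_span_sum (I : eqType) (r : seq I) (F : I -> A) n :
  (forall i, i \in r -> ghost_span n (F i)) -> ghost_span n (\sum_(i <- r) F i).
Proof.
elim: r => [_|i r IH rP]; first by rewrite big_nil; exact: ghost_span0.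
rewrite big_cons; apply: ghost_spanD; first by apply: rP; rewrite mem_head.
by apply: IH => j jr; apply: rP; rewrite inE jr orbT.
Qed.

Lemma ghost_spanZ n c x : ghost_span n x -> ghost_span n (c *: x).
Proof.
move=> [r [rP ->]]; rewrite scaler_sumr; apply: ghost_span_sum => i /rP[si di].
by rewrite scalerA; apply: ghost_span_term.
Qed.

Lemma ghost_span_widen m n x : ghost_span m x -> ghost_span (m + n) x.
Proof.
move=> [r [rP ->]]; apply: ghost_span_sum => i /rP[si di].
rewrite (path_ghost_expand n si) scaler_sumr; apply: ghost_span_sum => l.
rewrite mem_pathseq // => /andP[/eqP rl /eqP dl].
by apply: ghost_span_term; rewrite ?src_comp ?deg_comp ?di ?dl ?si.
Qed.

Lemma path_mul_span n l x : ghost_span n x -> ghost_span n (s l ** x).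
Proof.
move=> [r [rP ->]]; rewrite numul_sumr; apply: ghost_span_sum => i /rP[si di].
rewrite numulZr numulA; have [e|ne] := eqVneq (src l) (rng i.2.1).
  by rewrite path_comp //; apply: ghost_span_term; rewrite ?src_comp.
by rewrite path_mul0 // numul0l scaler0; exact: ghost_span0.
Qed.

(** Expanding by [deg l] makes each real path at least as long as [l]. Then (KP3) compares [l] with
    its initial segment and leaves the rest of the path or zero. *)
Lemma ghost_mul_span n l x :
  ghost_span n x -> ghost_span (n + deg l) (t l ** x).
Proof.
move=> [r [rP ->]]; rewrite numul_sumr; apply: ghost_span_sum => i /rP[si di].
rewrite numulZr (path_ghost_expand (deg l) si) numul_sumr; apply: ghost_spanZ.
apply: ghost_span_sum => m; rewrite mem_pathseq // => /andP[/eqP rm /eqP dm].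
set a := pcomp i.2.1 m; have la : leNk (deg l) (deg a).
  by rewrite deg_comp ?si // dm leNk_addl.
have [d e ae] := factP la.
rewrite {1}ae -path_comp // !numulA ghost_path //.
case: eqP => [le|_]; last by rewrite !numul0l; exact: ghost_span0.
have -> : src l = rng (rest (deg l) a) by rewrite {1}le.
rewrite vertex_path -[_ ** _]scale1r.
apply: ghost_span_term; last by rewrite deg_comp // di dm.
by rewrite src_rest // !src_comp ?si.
Qed.

End ExtendedFamily.

Section Spanning.
Variables (k : nat) (L : kgraph k) (R : comPzRingType).
Hypothesis rf : row_finite L.

Local Notation p := (@kp_p R k L).
Local Notation fam := (KP_generators_family R L).

Local Notation KP_path := (extend_path p (@kp_s R k L)).
Local Notation KP_ghost := (extend_path p (@kp_t R k L)).

Lemma KP_spanned (x : KP R L) :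
  exists n, ghost_span p (@kp_s R k L) (@kp_t R k L) n x.
Proof.
pose gs := ghost_span p (@kp_s R k L) (@kp_t R k L).
have gsD y z : (exists n, gs n y) -> (exists n, gs n z) ->
    exists n, gs n (y + z).
  move=> [m ym] [n zn]; exists (m + n); apply: ghost_spanD.
    exact (ghost_span_widen rf fam n ym).
  have -> : m + n = n + m by exact: addrC.
    exact (ghost_span_widen rf fam m zn).
have sP l y : (exists n, gs n y) -> exists n, gs n (KP_path l ** y).
  by move=> [n yn]; exists n; exact (path_mul_span fam l yn).
have tP l y : (exists n, gs n y) -> exists n, gs n (KP_ghost l ** y).
  by move=> [n yn]; exists (n + deg l); exact (ghost_mul_span rf fam l yn).
have sI l : exists n, gs n (KP_path l).
  exists 0; rewrite -[KP_path l]scale1r -(path_vertex fam).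
  rewrite -[p _](extend_path_idm p (@kp_t R k L)).
  by apply: ghost_span_term; rewrite ?src_idm ?deg_idm.
have tI l : exists n, gs n (KP_ghost l).
  exists (deg l); rewrite -[KP_ghost l]scale1r -(vertex_ghost fam).
  rewrite -[p _](extend_path_idm p (@kp_s R k L)).
  by apply: ghost_span_term; rewrite ?src_idm.
have nP c y : (exists n, gs n y) -> exists n, gs n (c *: y).
  by move=> [n yn]; exists n; exact: ghost_spanZ.
(* The induction on terms also carries stability under left multiplication by [x]; this settles
   products by associativity. *)
suff [] : (exists n, gs n x) /\
  forall y, (exists n, gs n y) -> exists n, gs n (x ** y) by [].
elim/kp_classW: x; elim=> [v|l|l||a [a1 a2] b [b1 b2]|a [a1 a2]|c a [a1 a2]
  |a [a1 a2] b [b1 b2]].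
- have -> : kp_class (TVertex R v) = KP_path (idm v).
    by rewrite extend_path_idm.
  by split=> *; [exact: sI|exact: sP].
- have -> : kp_class (TPath R l) = KP_path (val l).
    by rewrite extend_path_val.
  by split=> *; [exact: sI|exact: sP].
- have -> : kp_class (TGhost R l) = KP_ghost (val l).
    by rewrite extend_path_val.
  by split=> *; [exact: tI|exact: tP].
- have -> : kp_class (TZero R L) = 0 by [].
  by split=> [|y _]; rewrite ?numul0l; exists 0; exact: ghost_span0.
- have -> : kp_class (TAdd a b) = kp_class a + kp_class b.
    by rewrite -[RHS]/(KP_add _ _) KP_addE.
  by split=> *; rewrite ?numulDl; apply: gsD; auto.
- have -> : kp_class (TOpp a) = - kp_class a.
    by rewrite -[RHS]/(KP_opp _) KP_oppE.
  by rewrite -scaleN1r; split=> *; rewrite ?numulZl; apply: nP; auto.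
- have -> : kp_class (TScale c a) = c *: kp_class a.
    by rewrite -[RHS]/(KP_scale _ _) KP_scaleE.
  by split=> *; rewrite ?numulZl; apply: nP; auto.
- have -> : kp_class (TMul a b) = kp_class a ** kp_class b.
    by rewrite -[RHS]/(KP_mul _ _) KP_mulE.
  by split=> *; rewrite -?numulA; auto.
Qed.

End Spanning.

(** * Uniqueness *)

Lemma sum_fibers (V : nmodType) (I J : eqType) (r : seq I) (h : I -> J)
    (F : I -> V) :
  \sum_(i <- r) F i =
  \sum_(j <- undup (map h r)) \sum_(i <- r | h i == j) F i.
Proof.
rewrite (exchange_big_dep xpredT) //= big_seq [RHS]big_seq.
apply: eq_bigr => i ir; rewrite -big_filter.
under eq_filter => j do rewrite eq_sym.
by rewrite (filter_pred1_uniq (undup_uniq _)) ?big_seq1 // mem_undup map_f.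
Qed.

Section CuntzKriegerUniqueness.
Variables (k : nat) (L : kgraph k) (R : comPzRingType).
Hypothesis rf : row_finite L.

Local Notation A := (KP R L).
Local Notation P := (@kp_p R k L : vtx L -> A).
Local Notation S := (@kp_s R k L : nzmor L -> A).
Local Notation T := (@kp_t R k L : nzmor L -> A).
Local Notation s := (extend_path P S).
Local Notation t := (extend_path P T).
Local Notation fam := (KP_generators_family R L).

Lemma ghost_span_detect n x : ghost_span P S T n x -> x <> 0 ->
  exists2 b, deg b = n & x ** s b <> 0.
Proof.
move=> [r [rP xE]] x0; apply: contrapT => no.
have xb b : deg b = n -> x ** s b = 0.
  by move=> bn; apply: contrapT => xb; apply: no; exists b.
pose u := undup [seq i.2.2 | i <- r]; apply: x0.
(* The sum of $s_b t_b$ over the ghost paths [b] occurring in [x] is a right unit for [x], because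
   these have equal degree. So [x] vanishes if every $x s_b$ does. *)
have <- : x ** \sum_(b <- u) s b ** t b = x.
  rewrite {1}xE numul_suml xE big_seq [RHS]big_seq; apply: eq_bigr => i ir.
  have iu : i.2.2 \in u.
    by rewrite mem_undup; apply/mapP; exists i.
  rewrite numulZl numul_sumr (bigD1_seq i.2.2) ?undup_uniq //=.
  have [_ di] := rP i ir.
  rewrite -numulA (numulA (t _)) (ghost_path fam) // eqxx (vertex_ghost fam).
  rewrite big_seq_cond big1 ?addr0 // => b /andP[].
  rewrite mem_undup => /mapP[j /rP[_ dj] ->] ji.
  rewrite -numulA (numulA (t _)) (ghost_path fam) ?di ?dj //.
  by rewrite eq_sym (negPf ji) numul0l numul0r.
rewrite numul_sumr big_seq big1 // => b.
rewrite mem_undup => /mapP[j /rP[_ dj] ->].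
by rewrite numulA xb // numul0l.
Qed.

(** By (KP3) only the terms with ghost path [b] survive; these are then grouped by their real
    path. *)
Lemma ghost_span_mul_path n x b : ghost_span P S T n x -> deg b = n ->
  exists u : seq (mor L), exists f : mor L -> R,
    [/\ uniq u, forall a, a \in u -> src a = src b
      & x ** s b = \sum_(a <- u) f a *: s a].
Proof.
move=> [r [rP xE]] bn; pose r' := [seq i <- r | i.2.2 == b].
exists (undup [seq i.2.1 | i <- r']).
exists (fun a => \sum_(i <- r' | i.2.1 == a) i.1).
split; first exact: undup_uniq.
  move=> a; rewrite mem_undup => /mapP[i].
  by rewrite mem_filter => /andP[/eqP ib /rP[si _]] ->; rewrite si ib.
transitivity (\sum_(i <- r') i.1 *: s i.2.1); last first.
  rewrite [LHS](sum_fibers _ (fun i => i.2.1)); apply: eq_bigr => a _.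
  by rewrite scaler_suml; apply: eq_bigr => i /eqP <-.
rewrite big_filter xE numul_suml big_seq [RHS]big_seq_cond big_mkcondr /=.
apply: eq_bigr => i /rP[si di].
rewrite numulZl -numulA (ghost_path fam) ?di ?bn //.
case: eqP => [_|]; last by rewrite numul0r scaler0.
by rewrite -si (path_vertex fam).
Qed.

Lemma aperiodic_compression x : aperiodic L -> x <> 0 ->
  exists a b c w, c <> 0 /\ t a ** x ** s b = c *: P w.
Proof.
move=> ap x0; have [n xn] := KP_spanned rf x.
have [b bn xb0] := ghost_span_detect xn x0.
have [u [f [uu us xbE]]] := ghost_span_mul_path xn bn.
have [a au fa0] : exists2 a, a \in u & f a <> 0.
  apply: contrapT => no; apply: xb0; rewrite xbE big_seq big1 // => a au.
  suff -> : f a = 0 by rewrite scale0r.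
  by apply: contrapT => fa; apply: no; exists a.
pose N (a' : mor L) := joinNk (deg a) (deg a').
(* The pairs are the offsets into [l] that align [pcomp a l] with [pcomp a' l] at degree [N a'].
   They differ because the degrees of [a] and [a'] do. *)
have [|l ls lP] := @aperiodic_separates_seq _ _ (src b)
    [seq (subNk (N a') (deg a), subNk (N a') (deg a')) |
      a' <- [seq a' <- u | deg a' != deg a]] ap.
  move=> d /mapP[a']; rewrite mem_filter => /andP[da' _] -> /= e.
  case/eqP: da'; apply: (@addNkI _ (subNk (N a') (deg a))).
  by rewrite {1}e ![subNk _ _ + _]addrC !subNkK ?leNk_joinl ?leNk_joinr.
have al a' : a' \in u -> src a' = rng l by move/us; rewrite ls.
exists (pcomp a l), (pcomp b l), (f a), (src l); split=> //.
have bl : src b = rng l by rewrite ls.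
rewrite -(path_comp fam bl) numulA -(numulA _ x) xbE (bigD1_seq a) //=.
rewrite numulDr numulDl numulZr numulZl -numulA (path_comp fam) ?(al a) //.
rewrite (ghost_path fam) // eqxx src_comp ?(al a) //.
rewrite -big_filter numul_sumr numul_suml.
rewrite big_seq big1 ?addr0 // => a'; rewrite mem_filter => /andP[a'a a'u].
rewrite numulZr numulZl -numulA (path_comp fam) ?(al a') //.
suff -> : t (pcomp a l) ** s (pcomp a' l) = 0 by rewrite scaler0.
(* For equal degrees (KP3) suffices, as [a] and [a'] are distinct; otherwise the choice of [l] rules
   out common extensions. *)
have [da|da] := eqVneq (deg a') (deg a).
  rewrite (ghost_path fam) ?deg_comp ?(al a) ?(al a') ?da //; case: eqP => // e.
  have [e' _] := pcomp_inj (esym da) (al _ au) (al _ a'u) e.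
  by rewrite e' eqxx in a'a.
apply: (ghost_path_orthogonal rf fam) => c d.
rewrite !src_comp ?(al a) ?(al a') // => lc ld.
apply: separates_no_common_extension => //; rewrite ?(al a) ?(al a') //.
apply: (lP (_, _)); apply/mapP; exists a' => //.
by rewrite mem_filter da.
Qed.

End CuntzKriegerUniqueness.

(** * Infinite paths and vertex ideals *)

Section InfinitePaths.
Variables (k : nat) (L : kgraph k).
Implicit Types (l : mor L) (m n : Nk k).

(* An infinite path [x] given by its initial segments [hd x n = x(0, n)]. *)
Record ipath := IPath {
  hd : Nk k -> mor L;
  deg_hd : forall n, deg (hd n) = n;
  ini_hd_add : forall m n, ini m (hd (m + n)) = hd m
}.

Lemma ipath_eq (x y : ipath) : hd x =1 hd y -> x = y.
Proof.
case: x y => [f f1 f2] [g g1 g2] /= /funext e; case: _ / e g1 g2 => g1 g2.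
by rewrite (Prop_irrelevance f1 g1) (Prop_irrelevance f2 g2).
Qed.

Lemma ini_hd (x : ipath) m n : leNk m n -> ini m (hd x n) = hd x m.
Proof. by move=> mn; rewrite -(subNkK mn) ini_hd_add. Qed.

Lemma hd_rest (x : ipath) m n : leNk m n ->
  src (hd x m) = rng (rest m (hd x n)) /\
  hd x n = pcomp (hd x m) (rest m (hd x n)).
Proof.
move=> mn; have [|_] := @factP _ _ m (hd x n); first by rewrite deg_hd.
by rewrite ini_hd.
Qed.

Definition irng (x : ipath) := rng (hd x 0).

Lemma rng_hd x n : rng (hd x n) = irng x.
Proof.
have [s ->] := hd_rest x (leNk0 n).
by rewrite rng_comp.
Qed.

Lemma infinite_path_of_ipath (x : ipath) :
  exists X : infinite_path L, forall n, hom_vtx X n = src (hd x n).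
Proof.
have pq (f : mor (Omega k)) : leNk (Omega_rng f) (Omega_src f) := valP f.
have dq (f : mor (Omega k)) : leNk (Omega_rng f) (deg (hd x (Omega_src f))).
  by rewrite deg_hd.
(* The morphism $x(p,q)$ is what remains of $x(0,q)$ after removal of its initial segment of degree
   $p$. *)
unshelve eexists (@KGraphHom k (Omega k) L (fun n => src (hd x n))
  (fun f => rest (Omega_rng f) (hd x (Omega_src f))) _ _ _ _ _) => //.
- by move=> f; rewrite src_rest.
- by move=> f; case: (hd_rest x (pq f)).
- by move=> p; have := rest_deg (hd x p); rewrite deg_hd.
- move=> f g fg; rewrite -[pcomp f g]/(Omega_comp f g); cbv beta.
  rewrite Omega_rng_comp // Omega_src_comp //.
  have [s e] := hd_rest x (pq g); have fg' : Omega_src f = Omega_rng g by [].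
  by rewrite -fg' in s e *; rewrite [in LHS]e rest_compl.
- move=> f; rewrite -[RHS](addNkK (Omega_rng f)); apply/esym.
  by rewrite [_ + _]Omega_degK -[in LHS](deg_hd x (Omega_src f))
    -(deg_rest (dq f)) addNkK.
Qed.

Lemma ipath_of_infinite_path (X : infinite_path L) :
  exists x : ipath, forall n, src (hd x n) = hom_vtx X n.
Proof.
pose om m n : Omega_mor k :=
  exist (fun pq => leNk pq.1 pq.2) (m, m + n) (leNk_addr m n).
have d n : deg (hom_mor X (om 0 n)) = n.
  by rewrite hom_deg; apply: etrans (addNkK 0 n).
unshelve eexists (@IPath (fun n => hom_mor X (om 0 n)) d _) => /=.
  move=> m n; have e : Omega_src (om 0 m) = Omega_rng (om m n).
    exact: add0r.
  have -> : om 0 (m + n) = Omega_comp (om 0 m) (om m n).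
    apply: Omega_morP; rewrite ?Omega_rng_comp ?Omega_src_comp //.
    exact: add0r.
  rewrite (@hom_comp _ _ _ X) // -{1}(d m) ini_comp //.
  by rewrite hom_src hom_rng; congr hom_vtx.
by move=> n; rewrite hom_src; congr hom_vtx; exact: add0r.
Qed.

(** The path is built by steps of degree $(1,\dots,1)$, so only its diagonal vertices are known to
    satisfy [Q]. Any other vertex leads on to a diagonal one, hence the path [c] in the
    conclusion. *)
Lemma ipath_within (Q : vtx L -> Prop) (v : vtx L) :
  (forall w, Q w ->
    exists e, [/\ rng e = w, deg e = [ffun=> 1%N] & Q (src e)]) ->
  Q v -> exists2 x : ipath, irng x = v &
    forall n, exists c, rng c = src (hd x n) /\ Q (src c).
Proof.
move=> Qe Qv.
have /boolp.choice[st stP] w : exists e, Q w ->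
    [/\ rng e = w, deg e = [ffun=> 1%N] & Q (src e)].
  case: (pselect (Q w)) => [/Qe[e eP]|nQ].
    by exists e.
  by exists (idm w).
pose H := fix H j := if j is i.+1 then pcomp (H i) (st (src (H i))) else idm v.
have HP j : [/\ Q (src (H j)), rng (H j) = v & deg (H j) = [ffun=> j]].
  elim: j => [|j [q r d]] /=.
    by rewrite src_idm rng_idm deg_idm.
  have [r' d' q'] := stP _ q; rewrite src_comp // rng_comp // deg_comp //.
  by split=> //; rewrite d d'; apply/ffunP => i; rewrite addNkE !ffunE addn1.
have iH m i j : leNk m [ffun=> i] -> ini m (H (i + j)%N) = ini m (H i).
  move=> mi; elim: j => [|j <-]; first by rewrite addn0.
  have [q r d] := HP (i + j)%N; have [r' _ _] := stP _ q.
  rewrite addnS /= ini_compl // d; apply: leNk_trans mi _.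
  by apply/leNkP => i'; rewrite !ffunE leq_addr.
(* The sum of the coordinates bounds each of them and is additive, so [H (N (m + n))] extends
   [H (N m)]. *)
pose N (n : Nk k) := (\sum_i n i)%N.
have nN n : leNk n [ffun=> N n].
  by apply/leNkP => i; rewrite ffunE /N (bigD1 i) //= leq_addr.
have nH n : leNk n (deg (H (N n))) by have [_ _ ->] := HP (N n).
unshelve eexists (@IPath (fun n => ini n (H (N n))) _ _).
- by move=> n; case: (factP (nH n)).
- move=> m n; rewrite ini_ini ?leNk_addr //.
  have -> : N (m + n) = (N m + N n)%N.
    by rewrite /N -big_split; apply: eq_bigr => i _; exact: addNkE.
  exact: iH.
- by rewrite /irng /= rng_ini //; case: (HP (N 0)).
move=> n; exists (rest n (H (N n))); have [_ -> _] := factP (nH n).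
by rewrite src_rest //; case: (HP (N n)).
Qed.

Lemma ipath_through (v : vtx L) : no_sources L -> exists x : ipath, irng x = v.
Proof.
move=> ns; have [||x xv _] := @ipath_within (fun=> True) v => //.
  by move=> w _; have [e [? ?]] := ns w [ffun=> 1%N]; exists e.
by exists x.
Qed.

End InfinitePaths.

(** * The vertices whose idempotents lie in a given ideal *)

Section VertexIdeals.
Variables (k : nat) (L : kgraph k) (R : comPzRingType).
Hypothesis rf : row_finite L.

Local Notation A := (KP R L).
Local Notation P := (@kp_p R k L : vtx L -> A).
Local Notation s := (extend_path P (@kp_s R k L : nzmor L -> A)).
Local Notation t := (extend_path P (@kp_t R k L : nzmor L -> A)).
Local Notation fam := (KP_generators_family R L).

Variable I : set A.
Hypothesis iI : two_sided_ideal I.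

(** This is the identity $p_{s(l)} = t_l\,p_{r(l)}\,s_l$. *)
Lemma vertex_ideal_hereditary l : I (P (rng l)) -> I (P (src l)).
Proof.
move=> Il; have e := ghost_path fam (erefl (deg l)); rewrite eqxx in e.
rewrite -e -(vertex_path fam l).
by apply: (idealMl iI); exact: (idealMr iI).
Qed.

(** By (KP4), $p_v$ is a sum of terms $s_l\,p_{s(l)}\,t_l$. *)
Lemma vertex_ideal_saturated v n :
  (forall l, rng l = v -> deg l = n -> I (P (src l))) -> I (P v).
Proof.
move=> Iv; rewrite (vertex_sum fam v n); apply: (ideal_sum iI) => l.
rewrite mem_pathseq // => /andP[/eqP lv /eqP ln].
rewrite -(path_vertex fam l); apply: (idealMr iI); apply: (idealMl iI).
exact: Iv.
Qed.

(** If [w] were outside, saturation would give an infinite path from [w] each of whose vertices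
    leads outside. Cofinality joins [v] to one of these, against heredity. *)
Lemma vertex_ideal_cofinal v w : cofinal L -> I (P v) -> I (P w).
Proof.
move=> cof Iv; apply: contrapT => nIw.
have [u nIu|//|x _ xP] := @ipath_within _ _ (fun u => ~ I (P u)) w.
  apply: contrapT => no; apply: nIu.
  apply: (@vertex_ideal_saturated _ [ffun=> 1%N]) => e eu e1.
  by apply: contrapT => nIe; apply: no; exists e.
have [X XE] := infinite_path_of_ipath x; have [n [l [lv lX]]] := cof X v.
have [c [cx]] := xP n; apply.
apply: vertex_ideal_hereditary; rewrite cx -XE -lX.
by apply: vertex_ideal_hereditary; rewrite lv.
Qed.

Lemma vertex_ideal_full : (forall v, I (P v)) -> I = setT.
Proof.
move=> Iv; rewrite -subTset => x _; have [n [r [_ ->]]] := KP_spanned rf x.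
apply: (ideal_sum iI) => i _.
rewrite -(vertex_path fam) -numulA -numulZr.
exact: (idealMr iI).
Qed.

End VertexIdeals.

(** * Sufficiency of the conditions *)

Lemma simple_of_aperiodic_cofinal (k : nat) (L : kgraph k) (R : comPzRingType) :
  row_finite L -> is_field R -> aperiodic L -> cofinal L ->
  (exists v, kp_p R v <> 0 :> KP R L) -> simple_ring (KP R L).
Proof.
move=> rf [_ inv] ap cof [v pv0]; split.
  exists (kp_p R v), (kp_p R v).
  by rewrite (KP1 (KP_generators_family R L)) eqxx.
move=> I iI; have [I0|] := pselect (I `<=` [set 0]).
  left; apply/seteqP; split=> // x ->; exact: (ideal0 iI).
move=> /existsNP[x /not_implyP[Ix /eqP/eqP x0]]; right.
have [a [b [c [w [c0 abE]]]]] := aperiodic_compression rf ap x0.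
have [d dc] := inv c c0.
apply: (vertex_ideal_full rf iI) => u.
apply: (vertex_ideal_cofinal rf iI _ cof (v := w)).
(* Ideals need not be stable under scalars, so [c] is cancelled by multiplying with the algebra
   element [d *: kp_p R w]. *)
have -> : kp_p R w = d *: kp_p R w ** (c *: kp_p R w) :> KP R L.
  rewrite numulZl numulZr scalerA dc scale1r.
  by rewrite (KP1 (KP_generators_family R L)) eqxx.
rewrite -abE; apply: (idealMl iI); apply: (idealMr iI).
exact: (idealMl iI).
Qed.

(** * Representations on spaces of paths *)

Section Endomorphisms.
Variables (R : comPzRingType) (V : lmodType R).

Definition is_linear : {pred V -> V} := fun f => `[< linear f >].

Lemma is_linear_submod_closed : submod_closed is_linear.
Proof.
split=> [|c f g /asboolP lf /asboolP lg]; apply/asboolP => a u v /=.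
  by rewrite /= scaler0 addr0.
rewrite -[(c *: f + g) _]/(c *: f _ + g _) lf lg.
rewrite -[(c *: f + g) v]/(c *: f v + g v) !scalerDr !scalerA [c * a]mulrC.
exact: addrACA.
Qed.

HB.instance Definition _ :=
  GRing.isSubmodClosed.Build R (V -> V) is_linear is_linear_submod_closed.

Record endo := Endo {
  endo_fun :> V -> V;
  endo_linear : endo_fun \in is_linear
}.
HB.instance Definition _ := [isSub for endo_fun].
HB.instance Definition _ := [Choice of endo by <:].
HB.instance Definition _ := [SubChoice_isSubLmodule of endo by <:].

Lemma endoP (f : endo) : linear f.
Proof. exact/asboolP/endo_linear. Qed.

Lemma endoD (f : endo) u v : f (u + v) = f u + f v.
Proof. by have := endoP f 1 u v; rewrite !scale1r. Qed.

Lemma endo0 (f : endo) : f 0 = 0.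
Proof. by apply: (addIr (f 0)); rewrite -endoD !add0r. Qed.

Lemma endoZ (f : endo) c u : f (c *: u) = c *: f u.
Proof. by have := endoP f c u 0; rewrite endo0 !addr0. Qed.

Lemma comp_linear (f g : endo) : (f \o g) \in is_linear.
Proof. by apply/asboolP => a u v /=; rewrite !endoP. Qed.

Definition endo_mul f g : endo := Endo (comp_linear f g).

Lemma endo_eq (f g : endo) : f =1 g -> f = g.
Proof. by move=> fg; apply/val_inj/funext. Qed.

Lemma endo_mulA : associative endo_mul.
Proof. by move=> f g h; apply: endo_eq. Qed.
Lemma endo_mulDl : left_distributive endo_mul +%R.
Proof. by move=> f g h; apply: endo_eq. Qed.
Lemma endo_mulDr : right_distributive endo_mul +%R.
Proof. by move=> f g h; apply: endo_eq => u; exact: endoD. Qed.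
Lemma endo_mulZl c f g : endo_mul (c *: f) g = c *: endo_mul f g.
Proof. by apply: endo_eq. Qed.
Lemma endo_mulZr c f g : endo_mul f (c *: g) = c *: endo_mul f g.
Proof. by apply: endo_eq => u; exact: endoZ. Qed.

HB.instance Definition _ := Lmodule_hasNonUnitalMul.Build R endo
  endo_mulA endo_mulDl endo_mulDr endo_mulZl endo_mulZr.

End Endomorphisms.

(* An abstract space of paths on which finite paths can be removed from and
   prepended to points; [phd n y] and [ptl n y] play the role of [y(0, n)] and
   of the shift of [y] by [n]. *)
Record path_space k (L : kgraph k) := PathSpace {
  pt : Type;
  prng : pt -> vtx L;
  phd : Nk k -> pt -> mor L;
  ptl : Nk k -> pt -> pt;
  deg_phd : forall n y, deg (phd n y) = n;
  rng_phd : forall n y, rng (phd n y) = prng y;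
  src_phd : forall n y, src (phd n y) = prng (ptl n y);
  phd_add : forall m n y, phd (m + n) y = pcomp (phd m y) (phd n (ptl m y));
  ptl_add : forall m n y, ptl (m + n) y = ptl n (ptl m y);
  phd_ptl_inj : forall n y z, phd n y = phd n z -> ptl n y = ptl n z -> y = z;
  phd_ptl_surj : forall l y, src l = prng y ->
    exists z, phd (deg l) z = l /\ ptl (deg l) z = y
}.

Section Representation.
Variables (k : nat) (L : kgraph k) (R : comPzRingType) (X : path_space L).
Hypothesis rf : row_finite L.
Implicit Types (l m : mor L) (y z : pt X).

Lemma exists_prepend l y :
  exists z, src l = prng y -> phd (deg l) z = l /\ ptl (deg l) z = y.
Proof.
have [/phd_ptl_surj[z zP]|ne] := pselect (src l = prng y); first by exists z.
by exists y => e; case: ne.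
Qed.

(* Equal to [y] (junk) unless [src l = prng y]. *)
Definition prepend l y := sval (cid (exists_prepend l y)).

Lemma prependP l y : src l = prng y ->
  phd (deg l) (prepend l y) = l /\ ptl (deg l) (prepend l y) = y.
Proof. by rewrite /prepend; case: cid. Qed.

Lemma prng_prepend l y : src l = prng y -> prng (prepend l y) = rng l.
Proof. by move=> /prependP[h _]; rewrite -{2}h rng_phd. Qed.

Lemma prepend_uniq l y z : phd (deg l) z = l -> ptl (deg l) z = y ->
  prepend l y = z.
Proof.
move=> hz tz; have [|h t] := @prependP l y; first by rewrite -tz -src_phd hz.
by apply: (@phd_ptl_inj _ _ X (deg l)); rewrite ?h ?t.
Qed.

Lemma prepend_comp l m y : src l = rng m -> src m = prng y ->
  prepend (pcomp l m) y = prepend l (prepend m y).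
Proof.
move=> lm my; have [h2 t2] := prependP my.
have lmy : src l = prng (prepend m y) by rewrite prng_prepend.
have [h1 t1] := prependP lmy.
by apply: prepend_uniq; rewrite deg_comp // ?phd_add ?ptl_add t1 ?h1 ?h2.
Qed.

Lemma prepend_phd n y : prepend (phd n y) (ptl n y) = y.
Proof. by apply: prepend_uniq; rewrite deg_phd. Qed.

Local Notation V := (pt X -> R^o).

Definition vertex_op (v : vtx L) (f : V) : V :=
  fun y => if prng y == v then f y else 0.
(** On the indicator function of a point [y] with range [src l], this gives the indicator function
    of [prepend l y]. *)
Definition path_op l (f : V) : V :=
  fun y => if phd (deg l) y == l then f (ptl (deg l) y) else 0.
Definition ghost_op l (f : V) : V :=
  fun y => if prng y == src l then f (prepend l y) else 0.

Lemma vertex_op_linear v : vertex_op v \in @is_linear R V.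
Proof.
apply/asboolP => a f g; apply/funext => y.
rewrite -[RHS]/(a * _ + _) /vertex_op.
by case: ifP => // _; rewrite mulr0 addr0.
Qed.

Lemma path_op_linear l : path_op l \in @is_linear R V.
Proof.
apply/asboolP => a f g; apply/funext => y.
rewrite -[RHS]/(a * _ + _) /path_op.
by case: ifP => // _; rewrite mulr0 addr0.
Qed.

Lemma ghost_op_linear l : ghost_op l \in @is_linear R V.
Proof.
apply/asboolP => a f g; apply/funext => y.
rewrite -[RHS]/(a * _ + _) /ghost_op.
by case: ifP => // _; rewrite mulr0 addr0.
Qed.

Definition rep_p v : endo V := Endo (vertex_op_linear v).
Definition rep_s (l : nzmor L) : endo V := Endo (path_op_linear (val l)).
Definition rep_t (l : nzmor L) : endo V := Endo (ghost_op_linear (val l)).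

Lemma endo_sumE I (r : seq I) (F : I -> endo V) f y :
  (\sum_(i <- r) F i) f y = \sum_(i <- r) F i f y.
Proof. by elim/big_ind2: _ => // a b c d <- <-. Qed.

Lemma rep_family : KP_family rep_p rep_s rep_t.
Proof.
split.
- move=> v w; apply: endo_eq => f; apply/funext => y /=.
  rewrite /vertex_op; case: (eqVneq v w) => [<-|vw] /=.
    by rewrite /vertex_op; case: ifP => // ->.
  by case: eqP => // ->; rewrite (negPf vw).
- move=> l m lm; apply: endo_eq => f; apply/funext => y /=.
  rewrite /path_op /= deg_comp // phd_add ptl_add.
  have [h1|h1] := eqVneq (phd _ y) (val l).
    have s1 : src (val l) = rng (phd (deg (val m)) (ptl (deg (val l)) y)).
      by rewrite rng_phd -src_phd h1.
    rewrite h1; case: eqP => [->|h2]; first by rewrite eqxx.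
    by case: eqP => // /pcomp_inj[] // _ /h2.
  case: eqP => // e; case/eqP: h1.
  apply: (proj1 (@pcomp_inj _ _ _ _ _ _ _ _ _ e)) => //.
    by rewrite deg_phd.
  by rewrite rng_phd src_phd.
- move=> l m lm; apply: endo_eq => f; apply/funext => y /=.
  rewrite /ghost_op /= src_comp //; case: eqP => // ym.
  by rewrite prng_prepend // -[rng _]lm eqxx prepend_comp.
- move=> l; apply: endo_eq => f; apply/funext => y /=.
  rewrite /path_op /vertex_op; case: eqP => // yl; case: eqP => // h.
  by case: yl; rewrite -(rng_phd (deg (val l)) y) h.
- move=> l; apply: endo_eq => f; apply/funext => y /=.
  rewrite /path_op /vertex_op; case: eqP => // h.
  by rewrite -src_phd h eqxx.
- move=> l; apply: endo_eq => f; apply/funext => y /=.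
  by rewrite /ghost_op /vertex_op /nzsrc; case: eqP.
- move=> l; apply: endo_eq => f; apply/funext => y /=.
  rewrite /ghost_op /vertex_op; case: eqP => // h.
  by rewrite prng_prepend ?eqxx.
- move=> l m lm; apply: endo_eq => f; apply/funext => y /=.
  have -> : (if l == m then rep_p (nzsrc l) else 0) f y =
      if l == m then vertex_op (nzsrc l) f y else 0 by case: ifP.
  rewrite /ghost_op /path_op /vertex_op /nzsrc.
  have {}lm : deg (val l) = deg (val m) := lm.
  case: eqP => [yl|_]; last by case: ifP.
  have [h t] := prependP (esym yl).
  by rewrite -lm h t -(inj_eq val_inj).
- move=> v n n0; apply: endo_eq => f; apply/funext => y.
  rewrite endo_sumE /= /vertex_op.
  have hn : deg (phd n y) != 0 by rewrite deg_phd; apply/eqP.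
  (* Evaluated at [y], only the summand of the initial segment of [y] of degree [n] can be
     nonzero. *)
  pose h : nzmor L := exist _ (phd n y) hn.
  have [yv|yv] := eqVneq (prng y) v; last first.
    rewrite big_seq big1 // => l; rewrite nzpathsP // => /andP[/eqP lv /eqP ln].
    rewrite /= /path_op; case: eqP => // e; case/eqP: yv.
    by rewrite -lv -(rng_phd (deg (val l))) e.
  have hv : h \in nzpaths v n.
    by rewrite nzpathsP // /nzrng /nzdeg /= rng_phd deg_phd yv !eqxx.
  rewrite (big_fsetD1 h) //= big_seq big1 ?addr0 => [|l].
    by rewrite /path_op deg_phd eqxx /ghost_op -src_phd eqxx prepend_phd.
  rewrite !inE nzpathsP // => /and3P[lh /eqP lv /eqP ln].
  rewrite /= /path_op; case: eqP => // e; case/eqP: lh; apply: val_inj.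
  by rewrite /= -e; move: ln; rewrite /nzdeg => ->.
Qed.

Lemma path_space_rep : exists rep : KP R L -> (pt X -> R) -> pt X -> R,
  [/\ forall a b f y, rep (a + b) f y = rep a f y + rep b f y,
      forall c a f y, rep (c *: a) f y = c * rep a f y,
      forall a b f, rep (a ** b) f = rep a (rep b f),
      forall a, rep a (fun=> 0) = (fun=> 0)
    & (forall v f y, rep (kp_p R v) f y = if prng y == v then f y else 0) /\
      forall l f y, rep (extend_path (@kp_p R k L) (@kp_t R k L) l) f y =
        if prng y == src l then f (prepend l y) else 0].
Proof.
have [rep [[[rD rZ rM] [rp rs rt]] _]] := KP_universal rep_family.
exists (fun a f => rep a f); split=> [a b f y|c a f y|a b f|a|].
- by rewrite rD.
- by rewrite rZ.
- by rewrite rM.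
- exact: (endo0 (rep a)).
split=> [v f y|l f y]; first by rewrite rp.
elim/mor_ind: l => [v|l]; last by rewrite extend_path_val rt.
rewrite extend_path_idm rp src_idm /= /vertex_op; case: eqP => // yv.
(* In degree 0 the ghost formula reduces to the vertex formula, because prepending an identity
   changes nothing. *)
congr f; apply/esym/prepend_uniq; rewrite deg_idm.
  by rewrite (deg0_idm (deg_phd 0 y)) rng_phd yv.
apply: (@phd_ptl_inj _ _ X 0); last by rewrite -ptl_add addr0.
rewrite (deg0_idm (deg_phd 0 y)) (deg0_idm (deg_phd 0 (ptl 0 y))) !rng_phd.
by rewrite -src_phd (deg0_idm (deg_phd 0 y)) src_idm rng_phd.
Qed.

End Representation.

(** * Concrete path spaces: infinite paths, invariant subspaces, graded paths *)

Section IpathSpace.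
Variables (k : nat) (L : kgraph k).
Implicit Types (x y : ipath L) (m n : Nk k).

Lemma rest_hd_deg m x n : deg (rest m (hd x (m + n))) = n.
Proof.
by apply: (@addNkI _ m); rewrite deg_rest ?deg_hd // leNk_addr.
Qed.

Lemma rest_hd_ini m x n p :
  ini n (rest m (hd x (m + (n + p)))) = rest m (hd x (m + n)).
Proof.
rewrite -rest_ini ?deg_hd ?leNk_add ?leNk_addr //.
by rewrite ini_hd // leNk_add leNk_addr.
Qed.

Definition shift m x : ipath L := IPath (rest_hd_deg m x) (rest_hd_ini m x).

Lemma ipath_hd_shift_inj n x y :
  hd x n = hd y n -> shift n x = shift n y -> x = y.
Proof.
move=> hxy sxy; apply: ipath_eq => p.
rewrite -(ini_hd x (leNk_addl n p)) -(ini_hd y (leNk_addl n p)).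
have [_ ->] := hd_rest x (leNk_addr n p).
have [_ ->] := hd_rest y (leNk_addr n p).
by rewrite hxy -[rest n (hd x _)]/(hd (shift n x) p) sxy.
Qed.

Lemma ipath_prepend (l : mor L) y : src l = irng y ->
  exists x, hd x (deg l) = l /\ shift (deg l) x = y.
Proof.
move=> ly; have s n : src l = rng (hd y n) by rewrite rng_hd.
have d n : leNk n (deg (pcomp l (hd y n)))
  by rewrite deg_comp // deg_hd leNk_addl.
(* The segment of degree [n] of the new path can be read off [pcomp l (hd y n)], whose degree is at
   least [n]. *)
unshelve eexists (@IPath _ L (fun n => ini n (pcomp l (hd y n))) _ _).
- by move=> n; case: (factP (d n)).
- move=> m n; rewrite ini_ini ?leNk_addr //.
  have [c e] := hd_rest y (leNk_addr m n).
  by rewrite e pcompA // ini_compl ?src_comp.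
split; first by rewrite /= ini_comp.
apply: ipath_eq => n /=.
rewrite rest_ini ?deg_comp ?deg_hd ?leNk_add ?leNk_addl //.
by rewrite rest_comp // ini_hd // leNk_addl.
Qed.

Lemma src_hd n x : src (hd x n) = irng (shift n x).
Proof.
by rewrite /irng /= addr0; case: (hd_rest x (leNk_refl n)).
Qed.

Lemma hd_add m n x : hd x (m + n) = pcomp (hd x m) (hd (shift m x) n).
Proof. by case: (hd_rest x (leNk_addr m n)). Qed.

Lemma shift_add m n x : shift (m + n) x = shift n (shift m x).
Proof.
apply: ipath_eq => p /=; rewrite -addrA rest_add // deg_hd leNk_add.
exact: leNk_addr.
Qed.

Definition ipath_space : path_space L :=
  @PathSpace k L (ipath L) (@irng _ _) (fun n x => hd x n) shift
    (fun n x => deg_hd x n) (fun n x => rng_hd x n) src_hd hd_add shift_add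
    ipath_hd_shift_inj ipath_prepend.

End IpathSpace.

Section Subspace.
Variables (k : nat) (L : kgraph k) (X : path_space L) (Q : pt X -> Prop).
Hypothesis Q_ptl : forall n y, Q (ptl n y) <-> Q y.

Definition sub_ptl n (y : {y | Q y}) : {y | Q y} :=
  exist _ (ptl n (sval y)) (proj2 (Q_ptl n (sval y)) (svalP y)).

(** The equivalence [Q_ptl] also makes [Q] stable under prepending, since removing what was
    prepended returns the old point. *)
Definition sub_path_space : path_space L.
Proof.
refine (@PathSpace k L {y | Q y} (fun y => prng (sval y))
  (fun n y => phd n (sval y)) sub_ptl _ _ _ _ _ _ _).
- by move=> n y; exact: deg_phd.
- by move=> n y; exact: rng_phd.
- by move=> n y; exact: src_phd.
- by move=> m n y; exact: phd_add.
- by move=> m n y; apply: eq_exist; exact: ptl_add.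
- move=> n [y Qy] [z Qz] /= h /(congr1 sval) /= t; apply: eq_exist.
  exact: phd_ptl_inj h t.
- move=> l [y Qy] /= /phd_ptl_surj[z [h t]].
  have Qz : Q z by apply/(Q_ptl (deg l)); rewrite t.
  by exists (exist _ z Qz); split=> //; apply: eq_exist.
Defined.

End Subspace.

(* The second component records the [i]-th coordinate of the degree of what
   has been prepended or removed, so that this representation is graded. *)
Definition graded_path_space k (L : kgraph k) (X : path_space L) (i : 'I_k) :
  path_space L.
Proof.
refine (@PathSpace k L (pt X * int) (fun y => prng y.1)
  (fun n y => phd n y.1) (fun n y => (ptl n y.1, y.2 + (n i)%:Z))
  _ _ _ _ _ _ _).
- by move=> n y; exact: deg_phd.
- by move=> n y; exact: rng_phd.
- by move=> n y; exact: src_phd.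
- by move=> m n y; exact: phd_add.
- by move=> m n y; rewrite /= ptl_add addNkE PoszD addrA.
- move=> n [y c] [z d] /= h [t /addIr ->].
  by rewrite (phd_ptl_inj h t).
- move=> l [y c] /= /phd_ptl_surj[z [h t]].
  by exists (z, c - (deg l i)%:Z); rewrite /= h t subrK.
Defined.

(** * Necessity of the three conditions *)

Section Necessity.
Variables (k : nat) (L : kgraph k) (R : comPzRingType).
Hypothesis L_rf : row_finite L.
Hypothesis L_ns : no_sources L.

Lemma vertex_neq0 (v : vtx L) : (1 : R) <> 0 -> kp_p R v <> 0 :> KP R L.
Proof.
move=> R1 pv0; have [x xv] := ipath_through v L_ns.
have [rep [_ repZ _ _ [repp _]]] := path_space_rep R (ipath_space L) L_rf.
apply: R1; have := repp v (fun=> 1) x; rewrite /= xv eqxx => <-.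
by rewrite pv0 -(scale0r 0) repZ mul0r.
Qed.

(** The kernel is an ideal, and it is proper because $p_v$ fixes the value of the constant function
    1 at a point of range [v]. *)
Lemma simple_rep_injective (X : path_space L) v :
  simple_ring (KP R L) -> (1 : R) <> 0 -> (exists y : pt X, prng y = v) ->
  exists rep : KP R L -> (pt X -> R) -> pt X -> R,
  [/\ forall a, (forall f y, rep a f y = 0) -> a = 0,
      forall a b f y, rep (a - b) f y = rep a f y - rep b f y,
      forall v f y, rep (kp_p R v) f y = if prng y == v then f y else 0
    & forall l f y, rep (extend_path (@kp_p R k L) (@kp_t R k L) l) f y =
        if prng y == src l then f (prepend l y) else 0].
Proof.
move=> [_ simple] R1 [y0 y0v].
have [rep [repD repZ repM rep0 [repp rept]]] := path_space_rep R X L_rf.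
have repB a b f y : rep (a - b) f y = rep a f y - rep b f y.
  by rewrite -scaleN1r repD repZ mulN1r.
exists rep; split=> //.
pose K : set (KP R L) := [set a | forall f y, rep a f y = 0].
have repz f y : rep 0 f y = 0 by rewrite -(scale0r 0) repZ mul0r.
have iK : two_sided_ideal K.
  split=> [f y|a b Ka Kb f y|a Ka f y|a b Kb f y|a b Ka f y].
  - exact: repz.
  - by rewrite repD Ka Kb addr0.
  - by rewrite -[- a]add0r repB Ka repz subr0.
  - rewrite repM (_ : rep b f = fun=> 0) ?rep0 //.
    by apply/funext => z; exact: Kb.
  - by rewrite repM Ka.
have [K0 a Ka|KT] := simple K iK; first by have : K a by []; rewrite K0.
case: R1; have : K (kp_p R v) by rewrite KT.
by move=> /(_ (fun=> 1) y0); rewrite repp y0v eqxx.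
Qed.

Lemma simple_neq0 : simple_ring (KP R L) -> (1 : R) <> 0.
Proof.
move=> [[a [b ab]] _] R1; apply: ab.
by rewrite -[LHS]scale1r R1 scale0r.
Qed.

(** The multiples of [a] form an ideal containing the nonzero element $a p_v$, so $p_v = a y$ for
    some [y]. Applying both sides to the constant function 1 and evaluating at [x] exhibits an
    inverse of [a]. *)
Lemma simple_field : inhabited (vtx L) -> simple_ring (KP R L) -> is_field R.
Proof.
move=> [v] sKP; have R1 := simple_neq0 sKP; split=> // a a0.
have [x xv] := ipath_through v L_ns.
have [rep [_ repZ _ _ [repp _]]] := path_space_rep R (ipath_space L) L_rf.
have pvE f : rep (kp_p R v) f x = f x by rewrite repp /= xv eqxx.
pose I : set (KP R L) := [set z | exists y, z = a *: y].
have iI : two_sided_ideal I.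
  split.
  - by exists 0; rewrite scaler0.
  - by move=> _ _ [y ->] [z ->]; exists (y + z); rewrite scalerDr.
  - by move=> _ [y ->]; exists (- y); rewrite scalerN.
  - by move=> c _ [y ->]; exists (c ** y); rewrite numulZr.
  - by move=> _ c [y ->]; exists (y ** c); rewrite numulZl.
have [I0|IT] := sKP.2 I iI.
  case: a0; have : I (a *: kp_p R v) by exists (kp_p R v).
  rewrite I0 => /= e; have := repZ a (kp_p R v) (fun=> 1) x.
  by rewrite pvE mulr1 e -(scale0r 0) repZ mul0r.
have [y yE] : I (kp_p R v) by rewrite IT.
exists (rep y (fun=> 1) x).
by rewrite mulrC -repZ -yE pvE.
Qed.

Lemma simple_cofinal : simple_ring (KP R L) -> cofinal L.
Proof.
move=> sKP X v; have R1 := simple_neq0 sKP; apply: contrapT => no.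
have [x xX] := ipath_of_infinite_path X.
pose Q (y : ipath L) := exists m n, shift m y = shift n x.
have Q_shift n y : Q (shift n y) <-> Q y.
  split=> [[m [p e]]|[m [p e]]].
    by exists (n + m), p; rewrite shift_add.
  by exists m, (p + n); rewrite -shift_add addrC !shift_add e.
pose Y := @sub_path_space _ _ (ipath_space L) Q Q_shift.
have Qx : Q x by exists 0, 0.
have [|rep [rep_inj _ repp _]] := @simple_rep_injective Y (irng x) sKP R1.
  by exists (exist _ x Qx).
apply: (vertex_neq0 (v := v) R1); apply: rep_inj => f [y Qy].
rewrite repp; case: eqP => //= yv; case: no.
(* Since the tails of [y] after [m] and of [x] after [n] coincide, [hd y m] runs from [v] to the
   vertex $x(n)$. *)
have [m [n e]] := Qy; exists n, (hd y m).
by rewrite rng_hd yv src_hd e -src_hd xX.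
Qed.

Lemma not_separates_shift (v : vtx L) m n (x : ipath L) :
  (forall l, rng l = v -> ~ separates l m n) -> irng x = v ->
  shift m x = shift n x.
Proof.
move=> nsep xv; apply: ipath_eq => p /=.
(* With this degree, the two segments compared by [separates] have degree exactly [p]. *)
pose l := hd x (joinNk m n + p).
have := nsep l; rewrite /l rng_hd => /(_ xv) ne.
have {}ne : ini p (rest m l) = ini p (rest n l).
  apply: contrapT => ne'; apply: ne; split; rewrite deg_hd ?leNk_addr //.
  by rewrite addNkK.
have w q : leNk q (joinNk m n) -> ini p (rest q l) = rest q (hd x (q + p)).
  move=> qN; have qpN : leNk (q + p) (joinNk m n + p).
    by rewrite ![_ + p]addrC leNk_add.
  by rewrite -rest_ini ?deg_hd // ini_hd.
by rewrite -(w m) ?leNk_joinl // -(w n) ?leNk_joinr.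
Qed.

Lemma simple_aperiodic : simple_ring (KP R L) -> aperiodic L.
Proof.
move=> sKP; have R1 := simple_neq0 sKP.
apply/aperiodicP => v m n mn; apply: contrapT => no.
have {no}per x : irng x = v -> shift m x = shift n x.
  apply: not_separates_shift => l lv sl; apply: no; by exists l.
have [x0 x0v] := ipath_through v L_ns.
pose w := hd x0 (m + n).
have wm : leNk m (deg w) by rewrite deg_hd leNk_addr.
have wn : leNk n (deg w) by rewrite deg_hd leNk_addl.
(* The degrees are exchanged: [a] has degree [n] and [b] has degree [m]. *)
pose a := rest m w; pose b := rest n w.
have da : deg a = n by apply: (@addNkI _ m); rewrite /a deg_rest // deg_hd.
have db : deg b = m.
  by apply: (@addNkI _ n); rewrite /b deg_rest // deg_hd addrC.
have sa : src a = src w by rewrite src_rest.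
have sb : src b = src w by rewrite src_rest.
pose X := ipath_space L.
(* Both sides are shifts of the path [z] obtained by prepending [w] to [y], by [m] and by [n]
   respectively; these agree since [z] starts at [v]. *)
have prep (y : ipath L) : src w = irng y ->
    @prepend _ _ X a y = @prepend _ _ X b y.
  move=> wy; have [z [zw zy]] := ipath_prepend wy.
  have zv : irng z = v by rewrite -(rng_hd z (deg w)) zw rng_hd.
  have dw : deg w = m + n by rewrite deg_hd.
  rewrite dw in zw zy.
  have -> : @prepend _ _ X a y = shift m z.
    apply: (@prepend_uniq _ _ X); rewrite da; last by rewrite /= -shift_add.
    by rewrite /= zw.
  rewrite per //; apply/esym/(@prepend_uniq _ _ X); rewrite db /=.
    by rewrite addrC zw.
  by rewrite -shift_add addrC.
pose t := extend_path (@kp_p R k L) (@kp_t R k L).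
have tab : t a - t b = 0 :> KP R L.
  have [|rep [rep_inj repB _ rept]] := @simple_rep_injective X v sKP R1.
    by exists x0.
  apply: rep_inj => f y; rewrite repB !rept sa sb; case: eqP => [yw|].
    by rewrite prep ?subrr.
  by rewrite subrr.
(* Grading by a coordinate in which [m] and [n] differ distinguishes the ghosts of [a] and [b]. *)
have [i mi] : exists i, m i <> n i.
  apply: contrapT => no; apply: mn; apply/ffunP => i.
  by apply: contrapT => mi; apply: no; exists i.
pose Z := graded_path_space X i.
have [rep [_ repZ _ _ [_ rept]]] := path_space_rep R Z L_rf.
(* Shifting raises the grade, so prepending lowers it: from grade 0, [a] leads to grade [- n i] and
   [b] to [- m i]. The function [f] detects the former only. *)
pose f (y : pt Z) : R := if y.2 == - (n i)%:Z then 1 else 0.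
pose y : pt Z := (shift (m + n) x0, 0).
have yw : prng y = src w by rewrite /= /w src_hd.
have prep2 c : src c = src w -> (prepend c y).2 = - (deg c i)%:Z.
  move=> cw; have cy : src c = prng y by rewrite yw.
  have [_ /(congr1 snd) /= e] := prependP cy.
  by apply/eqP; rewrite -addr_eq0 e.
apply: R1; have : rep (t a) f y = rep (t b) f y by rewrite (subr0_eq tab).
rewrite !rept sa sb yw eqxx /f !prep2 // da db eqxx eqr_opp.
by case: eqP => [[/mi]|].
Qed.

End Necessity.

Theorem theorem6p1 (k : nat) (k_gt0 : (0 < k)%N) (L : kgraph k)
    (L_nonempty : inhabited (vtx L)) (L_rf : row_finite L)
    (L_ns : no_sources L) (R : comPzRingType) :
  simple_ring (KP R L) <-> is_field R /\ (aperiodic L /\ cofinal L).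
Proof.
split=> [sKP|[Rf [ap cof]]].
  split; first exact: simple_field.
  by split; [exact: simple_aperiodic sKP|exact: simple_cofinal sKP].
apply: simple_of_aperiodic_cofinal => //.
by case: L_nonempty => v; exists v; apply: vertex_neq0 => //; case: Rf.
Qed.
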